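(* Let $\mathbb{O}$ be an octonion algebra over a field $k$ of characteristic not two or three, and let $\mu_{\mathrm{Im}},\psi_{\mathrm{Im}},Q_{\mathrm{Im}}$ be the covariants of the special orthogonal representation $\rho : \mathfrak{g} \rightarrow \mathfrak{so}(\mathrm{Im}(\mathbb{O}),B)$ of the quadratic Lie algebra $(\mathfrak{g},B_{\mathfrak{g}})$ of type $G_2$ described in the context. Then: a) $\psi_{\mathrm{Im}}(v_1,v_2,v_3)=-\frac{3}{4}(v_1,v_2,v_3)$ for all $v_1,v_2,v_3\in \mathrm{Im}(\mathbb{O})$, where $(\ ,\ ,\ )$ is the associator; b) $Q_{\mathrm{Im}}(v_1,v_2,v_3,v_4)=-3B(v_1,(v_2,v_3,v_4))$ for all $v_1,v_2,v_3,v_4\in \mathrm{Im}(\mathbb{O})$; c) with respect to the basis $\{e_1,\dots,e_7\}$ of $\mathrm{Im}(\mathbb{O})$ described in the context, \begin{align*} \eta^{-1}(Q_{\mathrm{Im}})&=\frac{6}{q(e_1)q(e_2)q(e_4)}e_{1247}-\frac{6}{q(e_1)q(e_2)q(e_4)}e_{1256}-\frac{6}{q(e_1)q(e_2)q(e_4)}e_{1346}-\frac{6}{q(e_1)^2q(e_2)q(e_4)}e_{1357}\\ &\quad+\frac{6}{q(e_1)q(e_2)q(e_4)}e_{2345}-\frac{6}{q(e_1)q(e_2)^2q(e_4)}e_{2367}-\frac{6}{q(e_1)q(e_2)q(e_4)^2}e_{4567}; \end{align*} d) $\mu_{\mathrm{Im}} \circ \psi_{\mathrm{Im}}=0$ and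 $Q_{\mathrm{Im}}\wedge \mu_{\mathrm{Im}}=0$ in $\mathrm{Alt}_6(\mathrm{Im}(\mathbb{O}),\mathfrak{g})$.
   Context: $\mathbb{O}$ is an octonion (Cayley) algebra over $k$, i.e. an $8$-dimensional unital composition algebra, with norm $q$ and conjugation $u\mapsto\bar u$, $q(u)=u\bar u$; $\mathrm{Im}(\mathbb{O})=\{u\in\mathbb{O}: \bar u=-u\}$; $B$ is the symmetric bilinear form with $B(u,u)=q(u)$. The associator is $(u,v,w)=(uv)w-u(vw)$. Let $e_1,e_2,e_4\in\mathrm{Im}(\mathbb{O})$ be such that $\{e_1,e_2,e_1e_2,e_4,e_1e_4,e_2e_4,(e_1e_2)e_4\}$ is an orthogonal basis of $\mathrm{Im}(\mathbb{O})$ consisting of anisotropic vectors, and set $e_3=e_1e_2$, $e_5=e_1e_4$, $e_6=e_2e_4$, $e_7=(e_1e_2)e_4$. Write $e_{i_1\ldots i_n}=e_{i_1}\wedge\dots\wedge e_{i_n}$. The isomorphism $\eta:\Lambda^i(V)\to\Lambda^i(V)^*$, $V=\mathrm{Im}(\mathbb{O})$, is given by the determinant: $\eta(v_1\wedge\dots\wedge v_i)(w_1\wedge\dots\wedge w_i)=\det(B(v_a,w_b))$. Left multiplication $\rho(u)(x)=ux$ ($u\in\mathrm{Im}(\mathbb{O})$, $x\in\mathbb{O}$) satisfies $\rho(u)^2=-q(u)\mathrm{Id}$, hence extends to an algebra morphism $\rho:C(\mathrm{Im}(\mathbb{O}),-q)\to\mathrm{End}(\mathbb{O})$ from the Clifford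 algebra (in which $u^2=-q(u)$). Let $C^2(\mathrm{Im}(\mathbb{O}),-q)$ be the span of the elements $uv-vu$ with $u,v\in\mathrm{Im}(\mathbb{O})$, a Lie algebra under the commutator. Set $\mathfrak{g}=\{x\in C^2(\mathrm{Im}(\mathbb{O}),-q): \rho(x)(1)=0\}$. It is a Lie algebra of type $G_2$, $\rho(\mathfrak{g})$ is the Lie algebra of derivations of $\mathbb{O}$, and by restriction to $\mathrm{Im}(\mathbb{O})$ one gets $\rho:\mathfrak{g}\to\mathfrak{so}(\mathrm{Im}(\mathbb{O}),B)$. The quadratic form on $\mathfrak{g}$ is $B_{\mathfrak{g}}(x,y)=-\frac13\mathrm{Tr}(\rho(x)\rho(y))$. $\mathrm{Alt}_p(E,F)$ is the space of alternating $p$-linear maps from $E$ to $F$. The moment map $\mu=\mu_{\mathrm{Im}}\in\mathrm{Alt}_2(V,\mathfrak{g})$ is determined by $B_{\mathfrak{g}}(x,\mu(u,v))=B(\rho(x)(u),v)$ for all $x\in\mathfrak{g}$, $u,v\in V$; write $\mu(u,v)(w)$ for $\rho(\mu(u,v))(w)$. The representation is special orthogonal, meaning $\mu(u,v)(w)+\mu(u,w)(v)=B(u,v)w+B(u,w)v-2B(v,w)u$ for all $u,v,w \in V$. Its covariants are $\mu$, $\psi=\psi_{\mathrm{Im}}\in\mathrm{Alt}_3(V,V)$ and $Q=Q_{\mathrm{Im}}\in\mathrm{Alt}_4(V,k)$, where \begin{align*} \psi(v_1,v_2,v_3)&=\mu(v_1,v_2)(v_3)+\mu(v_3,v_1)(v_2)+\mu(v_2,v_3)(v_1),\\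 Q(v_1,v_2,v_3,v_4)&=B(v_1,\psi(v_2,v_3,v_4))-B(v_4,\psi(v_1,v_2,v_3))+B(v_3,\psi(v_4,v_1,v_2))-B(v_2,\psi(v_3,v_4,v_1)). \end{align*} The maps in d) are \begin{align*} (\mu\circ\psi)(v_1,\dots,v_6)&=\sum_{\sigma}\mathrm{sgn}(\sigma)\,\mu\big(\psi(v_{\sigma(1)},v_{\sigma(2)},v_{\sigma(3)}),\psi(v_{\sigma(4)},v_{\sigma(5)},v_{\sigma(6)})\big),\\ (Q\wedge\mu)(v_1,\dots,v_6)&=\sum_{\sigma}\mathrm{sgn}(\sigma)\,Q(v_{\sigma(1)},\dots,v_{\sigma(4)})\,\mu(v_{\sigma(5)},v_{\sigma(6)}), \end{align*} the sums being over the $(3,3)$-shuffle, respectively $(4,2)$-shuffle, permutations in $S_6$ (those increasing on each of the consecutive blocks of the given sizes). *)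

(* Defs.v *)
From HB Require Import structures.
From mathcomp Require Import all_boot all_order all_algebra all_fingroup.

Set Implicit Arguments.
Unset Strict Implicit.
Unset Printing Implicit Defensive.

Import GRing.Theory.
Local Open Scope ring_scope.

Section Multilinear.

Variables (k : fieldType) (V : lmodType k).

Definition tuple_set n (v : n.-tuple V) (i : 'I_n) (x : V) : n.-tuple V :=
  [tuple if j == i then x else tnth v j | j < n].

Definition multilinear (W : lmodType k) n (f : n.-tuple V -> W) : Prop :=
  forall (v : n.-tuple V) (i : 'I_n), linear (fun x => f (tuple_set v i x)).

Definition alternating (W : lmodType k) n (f : n.-tuple V -> W) : Prop :=
  forall (v : n.-tuple V) (i j : 'I_n),
    i != j -> tnth v i = tnth v j -> f v = 0.

(* (L, wedge) is the n-th exterior power of V, wedge v = v_1 /\ ... /\ v_n. *)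
Record is_exterior_power n (L : lmodType k) (wedge : n.-tuple V -> L) : Prop :=
  IsExteriorPower {
    wedge_multilinear : multilinear wedge;
    wedge_alternating : alternating wedge;
    wedge_lift : forall (W : lmodType k) (f : n.-tuple V -> W),
      multilinear f -> alternating f ->
      exists g : {linear L -> W}, forall v, g (wedge v) = f v;
    wedge_lift_unique : forall (W : lmodType k) (g h : {linear L -> W}),
      (forall v, g (wedge v) = h (wedge v)) -> g =1 h
  }.

(* (C, iota) is the Clifford algebra of (V, q), with the sign convention
   v ^ 2 = q v. *)
Record is_clifford_algebra (q : V -> k) (C : algType k)
    (iota : {linear V -> C}) : Prop := IsCliffordAlgebra {
  clifford_sqr : forall v, iota v * iota v = (q v)%:A;
  clifford_lift : forall (A : algType k) (f : {linear V -> A}),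
    (forall v, f v * f v = (q v)%:A) ->
    exists g : {lrmorphism C -> A}, forall v, g (iota v) = f v;
  clifford_lift_unique : forall (A : algType k) (g h : {lrmorphism C -> A}),
    (forall v, g (iota v) = h (iota v)) -> g =1 h
}.

(* Membership in C^2(V, q). *)
Definition in_clifford2 (C : algType k) (iota : {linear V -> C}) (x : C) : Prop :=
  exists (n : nat) (c : 'I_n -> k) (u v : 'I_n -> V),
    x = \sum_(i < n) c i *: (iota (u i) * iota (v i) - iota (v i) * iota (u i)).

End Multilinear.

Definition lfun_trace (k : fieldType) (V : vectType k) (f : 'End(V)) : k :=
  \tr (passmx.mxof (vbasis {:V}) (vbasis {:V}) f).

(* (p, n - p)-shuffles: increasing on {0, .., p - 1} and on {p, .., n - 1}. *)
Definition is_shuffle (p n : nat) (s : 'S_n) : bool :=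
  [forall i : 'I_n, forall j : 'I_n,
     (i < j)%N && ((j < p)%N || (p <= i)%N) ==> (s i < s j)%N].

(* 8-dimensional unital composition algebras: oct_normZ and oct_polar_bilinear
   say that the norm is a quadratic form, oct_nondegenerate that its polar form
   has no radical. *)
Record octonionAlg (k : fieldType) := OctonionAlg {
  oct_sort :> vectType k;
  oct_mul : {bilinear oct_sort -> oct_sort -> oct_sort};
  oct_one : oct_sort;
  oct_norm : oct_sort -> k;
  oct_dim : \dim {:oct_sort} = 8%N;
  oct_mul1l : left_id oct_one oct_mul;
  oct_mul1r : right_id oct_one oct_mul;
  oct_normZ : forall a x, oct_norm (a *: x) = a ^+ 2 * oct_norm x;
  oct_polar_bilinear : bilinear_for *%R *%R
    (fun x y => oct_norm (x + y) - oct_norm x - oct_norm y);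
  oct_nondegenerate : forall x,
    (forall y, oct_norm (x + y) - oct_norm x - oct_norm y = 0) -> x = 0;
  oct_normM : forall x y, oct_norm (oct_mul x y) = oct_norm x * oct_norm y
}.
Arguments oct_mul {k o}.

Section Octonions.

Variables (k : fieldType) (O : octonionAlg k).

(* Half the polar form, so that B(u, u) = q(u) in characteristic not 2. *)
Definition octB (x y : O) : k :=
  2%:R^-1 * (oct_norm (x + y) - oct_norm x - oct_norm y).

Fact octB_bilinear : bilinear_for *%R *%R octB.
Proof.
have [hl hr] := oct_polar_bilinear O.
by split=> u a x y; rewrite /octB ?hl ?hr mulrDr mulrCA.
Qed.
HB.instance Definition _ :=
  bilinear_isBilinear.Build k O O k *%R *%R octB octB_bilinear.

Lemma octBxx x : (2 \notin [pchar k])%N -> octB x x = oct_norm x.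
Proof.
rewrite inE /= => k2; rewrite /octB.
have -> : x + x = 2%:R *: x by rewrite scaler_nat mulr2n.
rewrite oct_normZ -addrA -opprD -mulr2n -[oct_norm x *+ 2]mulr_natl -mulrBl.
by rewrite -natrX -natrB // mulrA mulVf ?mul1r.
Qed.

(* The canonical involution 2 B(u, 1) 1 - u, for which u * conj u = q(u) 1. *)
Definition oct_conj (u : O) : O := (2%:R * octB u (oct_one O)) *: oct_one O - u.

Fact oct_conj_linear : linear oct_conj.
Proof.
move=> a x y; rewrite /oct_conj octB_bilinear.1 mulrDr scalerDl mulrCA.
by rewrite scalerBr scalerA opprD addrACA.
Qed.
HB.instance Definition _ := GRing.isSemilinear.Build k O O _ oct_conj
  (GRing.semilinear_linear oct_conj_linear).

Definition oct_assoc (u v w : O) : O :=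
  oct_mul (oct_mul u v) w - oct_mul u (oct_mul v w).

Definition oct_lmul (u : O) : 'End(O) := linfun (oct_mul u).

Definition im_space : {vspace O} := lker (linfun oct_conj + \1)%VF.

Lemma im_spaceP u : reflect (oct_conj u = - u) (u \in im_space).
Proof.
rewrite memv_ker add_lfunE id_lfunE lfunE addr_eq0.
apply: eqP.
Qed.

Definition imO : vectType k := subvs_of im_space.

Definition imB (u v : imO) : k := octB (vsval u) (vsval v).

Definition imq (u : imO) : k := oct_norm (vsval u).

Record is_cayley_basis (e1 e2 e3 e4 e5 e6 e7 : imO) : Prop := IsCayleyBasis {
  cayley_e3 : vsval e3 = oct_mul (vsval e1) (vsval e2);
  cayley_e5 : vsval e5 = oct_mul (vsval e1) (vsval e4);
  cayley_e6 : vsval e6 = oct_mul (vsval e2) (vsval e4);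
  cayley_e7 : vsval e7 = oct_mul (oct_mul (vsval e1) (vsval e2)) (vsval e4);
  cayley_basis : basis_of {:imO} [:: e1; e2; e3; e4; e5; e6; e7];
  cayley_orthogonal :
    pairwise (fun x y => imB x y == 0) [:: e1; e2; e3; e4; e5; e6; e7];
  cayley_anisotropic :
    all (fun x => imq x != 0) [:: e1; e2; e3; e4; e5; e6; e7]
}.

Section Covariants.

Variables (C : algType k) (iota : {linear imO -> C}) (rho : {linear C -> 'End(O)}).

Record is_clifford_action : Prop := IsCliffordAction {
  action1 : rho 1 = \1%VF;
  actionM : forall x y, rho (x * y) = (rho x \o rho y)%VF;
  action_iota : forall u, rho (iota u) = oct_lmul (vsval u)
}.

Definition in_g2 (x : C) : Prop := in_clifford2 iota x /\ rho x (oct_one O) = 0.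

(* rho x maps Im(O) to itself when x is in g, so vsproj (the projection onto
   Im(O) along some complement) only retypes values that already lie there. *)
Definition rho_im (x : C) : 'End(imO) :=
  (linfun (vsproj im_space) \o rho x \o linfun vsval)%VF.

Definition g2B (x y : C) : k :=
  - 3%:R^-1 * lfun_trace (rho_im x \o rho_im y)%VF.

Variable mu : imO -> imO -> C.

Record is_moment_map : Prop := IsMomentMap {
  moment_in_g2 : forall u v, in_g2 (mu u v);
  momentE : forall x u v, in_g2 x -> g2B x (mu u v) = imB (rho_im x u) v
}.

Definition psi_im (v1 v2 v3 : imO) : imO :=
  rho_im (mu v1 v2) v3 + rho_im (mu v3 v1) v2 + rho_im (mu v2 v3) v1.

Definition Q_im (v1 v2 v3 v4 : imO) : k :=
  imB v1 (psi_im v2 v3 v4) - imB v4 (psi_im v1 v2 v3)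
  + imB v3 (psi_im v4 v1 v2) - imB v2 (psi_im v3 v4 v1).

Definition mu_circ_psi (v : 6.-tuple imO) : C :=
  \sum_(s : 'S_6 | is_shuffle 3 s)
    let w := [tuple tnth v (s i) | i < 6] in
    (-1) ^+ s *: mu (psi_im w`_0 w`_1 w`_2) (psi_im w`_3 w`_4 w`_5).

Definition Q_wedge_mu (v : 6.-tuple imO) : C :=
  \sum_(s : 'S_6 | is_shuffle 4 s)
    let w := [tuple tnth v (s i) | i < 6] in
    ((-1) ^+ s * Q_im w`_0 w`_1 w`_2 w`_3) *: mu w`_4 w`_5.

End Covariants.

(* eta is the map from Lambda^n(Im(O)) to its dual defined by Gram determinants. *)
Definition is_eta n (L : vectType k) (wedge : n.-tuple imO -> L)
    (eta : 'Hom(L, 'Hom(L, k^o))) : Prop :=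
  forall v w : n.-tuple imO,
    eta (wedge v) (wedge w) = \det (\matrix_(a, b) imB (tnth v a) (tnth w b)).

End Octonions.

(* Main.v *)
From HB Require Import structures.
Require Import Defs.
From mathcomp Require Import all_boot all_order all_algebra all_fingroup.
From mathcomp Require Import ring.
From Stdlib Require Import Classical.

(** Everything follows from a closed formula for the moment map as an operator
on imaginary octonions,

      mu(u,v)(w) = B(u,w) v - B(v,w) u - (u,v,w)/4,

whose right-hand side is [moment_action].  Given the formula ([mu_moment]), the
first two terms cancel in the cyclic sum psi and the associator, which is
alternating, survives with coefficient -3/4.  Since B(v1, (v2,v3,v4)) is itself
alternating, the four terms of Q are equal and add up to -3 B(v1, (v2,v3,v4)).

Why the formula holds.  In the Clifford algebra, commutation with an element of
C^2 preserves the space of vectors.  For x in g, where rho(x) kills 1, this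
reads [rho(x), L_u] = L_(rho(x) u) for u imaginary: so rho(x) is a derivation of
the octonions, skew on the imaginary ones ([g2_vector], [g2_derivation]).
Cyclicity of the trace then gives Tr([L_p, L_q] rho(x)) = - 8 B(rho(x) p, q)
([trace_bracket]).  Conversely the operator mu(p,q) of the formula is a linear
combination of [L_p, L_q] and L_w + 2 R_w with w = [p,q]; the latter lies in
rho(C^2) ([lmul_rmul_clifford2]) and has trace zero against rho(g).  Hence it
comes from an element s of g with -(1/3) Tr(rho(s) rho(x)) = B(rho(x) p, q)
([moment_realized]).  Inserting s in the equation that defines the moment map
gives B(mu(u,v) p, q) = B(rho(s) u, v), and the formula is symmetric under
exchange of the pairs (u,v) and (p,q) ([moment_pair]).

For an orthogonal basis the map eta is diagonal on wedges of increasing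
families of basis vectors, so the inverse image of Q has as its coefficients
the values of Q on such families divided by their Gram determinants
([eta_inv]).  The multiplication table of a Cayley basis ([frame_mul]) leaves
seven nonzero values, on the complements of the lines of the Fano plane.

An element of g is determined by its action on vectors ([g2_reconstruct]), so
the vanishing of mu o psi and of Q /\ mu may be tested against every s in g:
with om(u,v) = B(rho(s) u, v), one needs two scalar alternating 6-forms on a
7-dimensional space to vanish, that is, 7 values of each.  In each case the
shuffle sum collapses to a multiple of

      om(uv, w) + om(vw, u) + om(wu, v),

which is zero because rho(s) is a skew derivation ([g2form_jacobi]). *)

Set Implicit Arguments.
Unset Strict Implicit.
Unset Printing Implicit Defensive.

Import GRing.Theory.
Local Open Scope ring_scope.

Local Notation "x ** y" := (oct_mul x y) (at level 40, left associativity).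
Local Notation "'1o" := (oct_one _).

(** * Composition algebra identities *)

(** Certificate for a linear consequence: chaining applications with well-chosen
coefficients reduces a goal, modulo several known equations, to one that the
ring tactic decides.  Vector identities are brought to this form by pairing
both sides with an arbitrary element. *)
Lemma eq_lincomb (R : pzRingType) (c a b x y : R) :
  x = y -> a - b = c * (x - y) -> a = b.
Proof. by move=> ->; rewrite subrr mulr0 => /subr0_eq. Qed.

Section CompositionAlgebra.

Variables (k : fieldType) (hk2 : (2 \notin [pchar k])%N) (O : octonionAlg k).
Local Notation B := (@octB k O).
Local Notation q := (@oct_norm k O).
Local Notation conj := (@oct_conj k O).
Implicit Types x y z w u v : O.

Lemma two_neq0 : 2%:R != 0 :> k.
Proof. by move: hk2; rewrite inE. Qed.
Lemma four_neq0 : 4%:R != 0 :> k.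
Proof. by rewrite (natrM _ 2 2) mulf_neq0 // two_neq0. Qed.
Lemma eight_neq0 : 8%:R != 0 :> k.
Proof. by rewrite (natrM _ 2 4) mulf_neq0 // ?two_neq0 ?four_neq0. Qed.

Lemma opp_self_eq0 (a : k) : a = - a -> a = 0.
Proof.
move/eqP; rewrite -subr_eq0 opprK -mulr2n -mulr_natl.
by rewrite mulf_eq0 (negbTE two_neq0) => /eqP.
Qed.

Lemma octBDl z x y : B (x + y) z = B x z + B y z. Proof. exact: linearDl. Qed.
Lemma octBDr z x y : B z (x + y) = B z x + B z y. Proof. exact: linearDr. Qed.
Lemma octBNl z x : B (- x) z = - B x z. Proof. exact: linearNl. Qed.
Lemma octBNr z x : B z (- x) = - B z x. Proof. exact: linearNr. Qed.
Lemma octBZl z a x : B (a *: x) z = a * B x z. Proof. exact: linearZl_LR. Qed.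
Lemma octBZr z a x : B z (a *: x) = a * B z x. Proof. exact: linearZr_LR. Qed.
Lemma octB0l z : B 0 z = 0. Proof. exact: linear0l. Qed.
Lemma octB0r z : B z 0 = 0. Proof. exact: linear0r. Qed.
Definition octBlin := (octBDl, octBDr, octBNl, octBNr, octBZl, octBZr).

Lemma octBPl a u v w : B (a *: u + v) w = a * B u w + B v w.
Proof. by rewrite octBDl octBZl. Qed.
Lemma octBPr a u v w : B w (a *: u + v) = a * B w u + B w v.
Proof. by rewrite octBDr octBZr. Qed.

Lemma octMDl z x y : (x + y) ** z = x ** z + y ** z. Proof. exact: linearDl. Qed.
Lemma octMDr z x y : z ** (x + y) = z ** x + z ** y. Proof. exact: linearDr. Qed.
Lemma octMNl z x : (- x) ** z = - (x ** z). Proof. exact: linearNl. Qed.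
Lemma octMNr z x : z ** (- x) = - (z ** x). Proof. exact: linearNr. Qed.
Lemma octMZl z a x : (a *: x) ** z = a *: (x ** z). Proof. exact: linearZl_LR. Qed.
Lemma octMZr z a x : z ** (a *: x) = a *: (z ** x). Proof. exact: linearZr_LR. Qed.
Lemma octM0l z : 0 ** z = 0. Proof. exact: linear0l. Qed.
Lemma octM0r z : z ** 0 = 0. Proof. exact: linear0r. Qed.
Lemma oct1M x : '1o ** x = x. Proof. exact: oct_mul1l. Qed.
Lemma octM1 x : x ** '1o = x. Proof. exact: oct_mul1r. Qed.
Definition octMlin :=
  (oct1M, octM1, octMDl, octMDr, octMNl, octMNr, octMZl, octMZr).

Lemma octBC x y : B x y = B y x.
Proof. by rewrite /octB (addrC x y); ring. Qed.

Lemma octBE x : B x x = q x.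
Proof. exact: octBxx. Qed.

Lemma octB_nondeg x y : (forall z, B x z = B y z) -> x = y.
Proof.
move=> h; apply/eqP; rewrite -subr_eq0; apply/eqP/oct_nondegenerate => z.
have : B (x - y) z = 0 by rewrite octBDl octBNl h subrr.
by move/eqP; rewrite mulf_eq0 invr_eq0 (negbTE two_neq0) /= => /eqP.
Qed.

Lemma octB_mull x y z : B (x ** y) (x ** z) = q x * B y z.
Proof. by rewrite /octB -octMDr !oct_normM; ring. Qed.

Lemma octB_mulr x y z : B (y ** x) (z ** x) = B y z * q x.
Proof. by rewrite /octB -octMDl !oct_normM; ring. Qed.

(** Polarisation of [octB_mulr] in its repeated factor. *)
Lemma octB_exchange x y z w :
  B (x ** y) (z ** w) + B (x ** w) (z ** y) = 2%:R * B x z * B y w.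
Proof.
have := octB_mulr (y + w) x z; rewrite -[q (y + w)]octBE !octMlin !octBlin.
rewrite !octB_mulr (octBC w y) -!octBE => h.
by apply: (eq_lincomb (c := 1) h); ring.
Qed.

(** The norm is multiplicative and not identically zero, since a zero polar form
would make the whole algebra radical. *)
Lemma oct_norm1 : q '1o = 1.
Proof.
have [x nzx] : exists x, q x != 0.
  apply: NNPP => h; have q0 x : q x = 0.
    by apply/eqP; apply: contraT => nz; case: h; exists x.
  have : \dim {:O} = 0%N.
    apply/eqP; rewrite dimv_eq0 -subv0; apply/subvP => x _; rewrite memv0.
    by apply/eqP/oct_nondegenerate => y; rewrite !q0 !subr0.
  by rewrite oct_dim.
by apply: (mulIf nzx); rewrite mul1r -oct_normM oct1M.
Qed.

Lemma octB11 : B '1o '1o = 1. Proof. by rewrite octBE oct_norm1. Qed.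

(** Both adjunctions are [octB_exchange] with one factor equal to the unit. *)
Lemma octB_adjl x y z : B (x ** y) z = B y (conj x ** z).
Proof.
have := octB_exchange x y '1o z; rewrite !oct1M => h.
rewrite /oct_conj !octMlin !octBlin (octBC y (x ** z)).
by apply: (eq_lincomb (c := 1) h); ring.
Qed.

Lemma octB_adjr x y z : B (y ** x) z = B y (z ** conj x).
Proof.
have := octB_exchange y x z '1o; rewrite !octM1 => h.
by rewrite /oct_conj !octMlin !octBlin; apply: (eq_lincomb (c := 1) h); ring.
Qed.

Lemma oct_conjK : involutive conj.
Proof.
move=> x; apply: octB_nondeg => z; rewrite /oct_conj !octBlin octB11; ring.
Qed.

Lemma octB_conj x y : B (conj x) (conj y) = B x y.
Proof. by rewrite /oct_conj !octBlin octB11 (octBC '1o y); ring. Qed.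

Lemma oct_conjM_mul x y : conj x ** (x ** y) = q x *: y.
Proof.
apply: octB_nondeg => z.
by rewrite octB_adjl oct_conjK octB_mull octBZl.
Qed.

Lemma octB_conjl x y : B (conj x) y = B x (conj y).
Proof. by rewrite -octB_conj oct_conjK. Qed.

(** Move everything across the form: both sides pair with z to the same value
after three adjunctions. *)
Lemma oct_conjM x y : conj (x ** y) = conj y ** conj x.
Proof.
apply: octB_nondeg => z.
rewrite octB_conjl octB_adjr octBC octB_adjl oct_conjK octB_adjr oct_conjK.
by rewrite octBC.
Qed.

Definition imag x := B x '1o = 0.

Lemma imag_spaceP x : reflect (imag x) (x \in im_space O).
Proof.
apply: (iffP (im_spaceP x)) => [h|h]; last first.
  by rewrite /oct_conj h mulr0 scale0r sub0r.
have: B (conj x) '1o = B (- x) '1o by rewrite h.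
rewrite /oct_conj !octBlin octB11 => /eqP.
rewrite mulr1 -subr_eq0 opprK subrK mulf_eq0 (negbTE two_neq0) /=.
by move/eqP.
Qed.

Lemma conj_imag x : imag x -> conj x = - x.
Proof. by move/imag_spaceP/im_spaceP. Qed.

Lemma imag_val (u : imO O) : imag (vsval u).
Proof. exact/imag_spaceP/subvsP. Qed.

Lemma imagD x y : imag x -> imag y -> imag (x + y).
Proof. by rewrite /imag octBDl => -> ->; rewrite addr0. Qed.
Lemma imagN x : imag x -> imag (- x).
Proof. by rewrite /imag octBNl => ->; rewrite oppr0. Qed.
Lemma imagZ a x : imag x -> imag (a *: x).
Proof. by rewrite /imag octBZl => ->; rewrite mulr0. Qed.

Lemma imag_proj x : imag (x - B x '1o *: '1o).
Proof. by rewrite /imag !octBlin octB11 mulr1 subrr. Qed.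

Lemma octB_skewl u x y : imag u -> B (u ** x) y = - B x (u ** y).
Proof. by move=> iu; rewrite octB_adjl conj_imag // octMNl octBNr. Qed.
Lemma octB_skewr u x y : imag u -> B (x ** u) y = - B x (y ** u).
Proof. by move=> iu; rewrite octB_adjr conj_imag // octMNr octBNr. Qed.

Lemma imag_mul2 u x : imag u -> u ** (u ** x) = - q u *: x.
Proof.
by move=> /conj_imag iu; rewrite scaleNr -oct_conjM_mul iu octMNl opprK.
Qed.

(** Polarisation of [imag_mul2]: left multiplications by imaginary elements
represent the Clifford algebra of the opposite of the norm. *)
Lemma clifford_mul u v x : imag u -> imag v ->
  u ** (v ** x) + v ** (u ** x) = (- 2%:R * B u v) *: x.
Proof.
move=> iu iv; have := imag_mul2 x (imagD iu iv).
rewrite !octMlin !imag_mul2 // -!octBE !octBlin (octBC v u) => h.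
apply: octB_nondeg => z; have := congr1 (B^~ z) h; rewrite !octBlin => h'.
by apply: (eq_lincomb (c := 1) h'); ring.
Qed.

End CompositionAlgebra.

(** * The associator on imaginary elements *)

Section Associator.

Variables (k : fieldType) (hk2 : (2 \notin [pchar k])%N) (O : octonionAlg k).
Local Notation B := (@octB k O).
Local Notation conj := (@oct_conj k O).
Local Notation assoc := (@oct_assoc k O).
Implicit Types x y z w u v : O.

Lemma imag_anticomm u v : imag u -> imag v ->
  u ** v + v ** u = (- 2%:R * B u v) *: '1o.
Proof. by move=> iu iv; have := clifford_mul hk2 '1o iu iv; rewrite !octM1. Qed.

(** The mirror image of [clifford_mul] under conjugation. *)
Lemma clifford_mulr x u v : imag u -> imag v ->
  x ** u ** v + x ** v ** u = (- 2%:R * B u v) *: x.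
Proof.
move=> iu iv.
have := congr1 conj (clifford_mul hk2 (conj x) iu iv).
rewrite linearD linearZ /= !oct_conjM // !oct_conjK //.
by rewrite !conj_imag // !octMlin !opprK addrC.
Qed.

Lemma octB_mul1 u v : imag u -> imag v -> B (u ** v) '1o = - B u v.
Proof. by move=> iu iv; rewrite octB_skewl // octM1 octBC. Qed.

(** The Clifford relations on the left and on the right are the linearised
alternative laws. *)
Lemma assoc12 u v w : imag u -> imag v -> assoc u v w = - assoc v u w.
Proof.
move=> iu iv; apply: (octB_nondeg hk2) => z.
have := congr1 (B^~ z) (clifford_mul hk2 w iu iv).
have := congr1 (B^~ z \o (fun x => x ** w)) (imag_anticomm iu iv).
rewrite /oct_assoc /= !octMlin !octBlin => h1 h2.
by apply: (eq_lincomb (c := 1) h1); apply: (eq_lincomb (c := -1) h2); ring.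
Qed.

Lemma assoc23 u v w : imag v -> imag w -> assoc u v w = - assoc u w v.
Proof.
move=> iv iw; apply: (octB_nondeg hk2) => z.
have := congr1 (B^~ z) (clifford_mulr u iv iw).
have := congr1 (B^~ z \o (fun x => u ** x)) (imag_anticomm iv iw).
rewrite /oct_assoc /= !octMlin !octBlin => h1 h2.
by apply: (eq_lincomb (c := -1) h1); apply: (eq_lincomb (c := 1) h2); ring.
Qed.

Lemma assoc_cyc u v w : imag u -> imag v -> imag w -> assoc u v w = assoc v w u.
Proof. by move=> iu iv iw; rewrite assoc12 // assoc23 // opprK. Qed.

Lemma imag_assoc u v w : imag u -> imag v -> imag w -> imag (assoc u v w).
Proof.
move=> iu iv iw; rewrite /imag /oct_assoc !octBlin.
rewrite (octB_skewr hk2) // (octB_skewl hk2 (v ** w)) // oct1M octM1.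
by rewrite (octB_skewr hk2 _ _ iw) // (octB_skewl hk2) // opprK subrr.
Qed.

(** Together with [assoc12] and [assoc23] this makes B((u,v,w), z) an alternating
4-form.  Moving the outer factors across B turns the sum of the two sides into
an instance of [octB_exchange]. *)
Lemma assoc_skew34 u v w z : imag u -> imag v -> imag w -> imag z ->
  B (assoc u v w) z = - B (assoc u v z) w.
Proof.
move=> iu iv iw iz; rewrite /oct_assoc !octBlin.
rewrite (octB_skewr hk2 _ _ iw) (octB_skewr hk2 _ _ iz).
rewrite (octB_skewl hk2 (v ** w) _ iu) (octB_skewl hk2 (v ** z) _ iu).
have := octB_exchange hk2 v w u z.
have := congr1 (B (u ** v)) (imag_anticomm iw iz).
rewrite !octBlin octB_mul1 // => h1 h2.
apply: (eq_lincomb (c := -1) h1); apply: (eq_lincomb (c := 1) h2).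
by rewrite (octBC v u); ring.
Qed.

Lemma assocPl a u u' v w : assoc (a *: u + u') v w = a *: assoc u v w + assoc u' v w.
Proof. by rewrite /oct_assoc !octMlin scalerBr opprD addrACA. Qed.
Lemma assocPm a u u' v w : assoc v (a *: u + u') w = a *: assoc v u w + assoc v u' w.
Proof. by rewrite /oct_assoc !octMlin scalerBr opprD addrACA. Qed.
Lemma assocPr a u u' v w : assoc v w (a *: u + u') = a *: assoc v w u + assoc v w u'.
Proof. by rewrite /oct_assoc !octMlin scalerBr opprD addrACA. Qed.

Lemma assoc_xx u v : imag u -> assoc u u v = 0.
Proof.
move=> iu; apply: (octB_nondeg hk2) => w; rewrite octB0l.
by apply: (opp_self_eq0 hk2); rewrite {1}assoc12 // octBNl.
Qed.

Lemma assoc_yy u v : imag u -> assoc v u u = 0.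
Proof.
move=> iu; apply: (octB_nondeg hk2) => w; rewrite octB0l.
by apply: (opp_self_eq0 hk2); rewrite {1}assoc23 // octBNl.
Qed.

Lemma octB_assoc_xx u v w : imag u -> imag v -> imag w -> B u (assoc u v w) = 0.
Proof.
move=> iu iv iw; apply: (opp_self_eq0 hk2).
by rewrite (assoc_cyc iu iv iw) octBC {1}assoc_skew34.
Qed.

Lemma mul_outer u v w : imag u -> imag v -> imag w ->
  w ** (u ** v) = u ** (v ** w) + (2%:R * B v w) *: u - (2%:R * B u w) *: v.
Proof.
move=> iu iv iw; apply: (octB_nondeg hk2) => z.
have := congr1 (B^~ z) (assoc_cyc iw iu iv).
have := congr1 (B^~ z \o (fun x => x ** v)) (imag_anticomm iu iw).
have := congr1 (B^~ z) (assoc23 u iw iv).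
have := congr1 (B^~ z \o (fun x => u ** x)) (imag_anticomm iv iw).
rewrite /oct_assoc /= !octMlin !octBlin => hD hC hB hA.
apply: (eq_lincomb (c := -1) hA); apply: (eq_lincomb (c := 1) hB).
by apply: (eq_lincomb (c := -1) hC); apply: (eq_lincomb (c := -1) hD); ring.
Qed.

(** The alternating part of the double commutator is a multiple of the
associator, and its remaining part is elementary.  Through this identity the
standard inner derivation w |-> [[u,v],w] - 3(u,v,w) is four times
[moment_action]. *)
Lemma double_commutator u v w : imag u -> imag v -> imag w ->
  (u ** v - v ** u) ** w - w ** (u ** v - v ** u) =
  2%:R *: assoc u v w + (4%:R * B u w) *: v - (4%:R * B v w) *: u.
Proof.
move=> iu iv iw; have -> : v ** u = (- 2%:R * B u v) *: '1o - u ** v.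
  by rewrite -(imag_anticomm iu iv) addrC addKr.
rewrite /oct_assoc !octMlin mul_outer //; apply: (octB_nondeg hk2) => z.
by rewrite !octBlin; ring.
Qed.

End Associator.

(** * Orthogonal families *)

Section Orthogonal.

Variables (k : fieldType) (hk2 : (2 \notin [pchar k])%N) (O : octonionAlg k).
Local Notation B := (@octB k O).
Local Notation q := (@oct_norm k O).
Implicit Types (x y z w u v : O) (s : seq O).

Definition orthogonal_seq s :=
  pairwise (fun x y => B x y == 0) s && all (fun x => q x != 0) s.

(** For orthogonal anisotropic s, the projection onto the orthogonal of s. *)
Definition orth_coproj s x := x - \sum_(y <- s) (B x y / q y) *: y.

Lemma orthogonal_span s w x :
  (forall y, y \in s -> B w y = 0) -> x \in <<s>>%VS -> B w x = 0.
Proof.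
move=> h /(@coord_span _ _ _ (in_tuple s)) ->.
rewrite linear_sumr big1 // => i _.
by rewrite /= octBZr h ?mulr0 // mem_nth.
Qed.

Lemma orth_coprojP s x y :
  orthogonal_seq s -> y \in s -> B (orth_coproj s x) y = 0.
Proof.
rewrite /orth_coproj; elim: s y => [|a s IH] y //=.
case/andP=> /= /andP[/allP /= ha hs] /andP[qa qs].
have {}IH z : z \in s -> _ := IH z (introT andP (conj hs qs)).
rewrite big_cons opprD addrCA octBDl octBNl octBZl inE => /predU1P[->|ys].
  rewrite octBDl octBNl linear_sumlz big_seq big1 => [|z zs].
    by rewrite -octBE // in qa *; rewrite divfK // subr0 addNr.
  by rewrite /= octBZl (octBC z) (eqP (ha z zs)) mulr0.
by rewrite (eqP (ha y ys)) mulr0 oppr0 add0r IH.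
Qed.

Lemma orth_coproj_span s x : x - orth_coproj s x \in <<s>>%VS.
Proof.
rewrite /orth_coproj opprB addrC subrK big_seq memv_suml // => y ys.
by rewrite memvZ // memv_span.
Qed.

Lemma orthogonal_free s : orthogonal_seq s -> free s.
Proof.
elim: s => [|a s IH]; first by rewrite nil_free.
case/andP=> /= /andP[/allP /= ha hs] /andP[qa qs].
rewrite free_cons IH ?/orthogonal_seq ?hs // andbT.
apply: contra qa => /(@orthogonal_span s a a) <-; first by rewrite octBE.
by move=> y /ha/eqP.
Qed.

Lemma orthogonal_expand s x : orthogonal_seq s -> size s = 8%N ->
  x = \sum_(y <- s) (B x y / q y) *: y.
Proof.
move=> os s8; apply/eqP; rewrite -subr_eq0 -/(orth_coproj s x); apply/eqP.
apply: (octB_nondeg hk2) => z; rewrite octB0l.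
apply: (@orthogonal_span s) => [y|]; first exact: orth_coprojP.
have /span_basis -> : basis_of {:O} s; last by rewrite memvf.
by rewrite basisEfree orthogonal_free // oct_dim s8 leqnn andbT subvf.
Qed.

(** Otherwise the orthogonal of s is totally isotropic, hence orthogonal to
itself as well as to s, hence zero; then s spans, which its size forbids. *)
Lemma orthogonal_extend s : orthogonal_seq s -> (size s < 8)%N ->
  exists w, (forall y, y \in s -> B w y = 0) /\ q w != 0.
Proof.
move=> os s8; apply: NNPP => none.
have isotropic w : (forall y, y \in s -> B w y = 0) -> q w = 0.
  by move=> hw; apply/eqP; apply: contraT => qw; case: none; exists w.
suff sf : (fullv <= <<s>>)%VS.
  by have := leq_trans (dimvS sf) (dim_span s); rewrite oct_dim leqNgt s8.
have o z y : y \in s -> B (orth_coproj s z) y = 0 by exact: orth_coprojP.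
apply/subvP => x _; suff x0 : orth_coproj s x = 0.
  by rewrite -[x]subr0 -x0 orth_coproj_span.
apply: (octB_nondeg hk2) => y; rewrite octB0l -[y](subrK (orth_coproj s y)).
rewrite octBDr (orthogonal_span _ (orth_coproj_span s y)); last exact: o.
rewrite /octB !isotropic; first by ring.
- exact: o.
- exact: o.
by move=> z zs; rewrite octBDl !o // addr0.
Qed.

End Orthogonal.

(** * Cayley frames and their multiplication table *)

Section CayleyFrame.

Variables (k : fieldType) (hk2 : (2 \notin [pchar k])%N) (O : octonionAlg k).
Local Notation B := (@octB k O).
Local Notation q := (@oct_norm k O).
Implicit Types (x y z w u v : O) (s : seq O).

(** Data from which a Cayley basis is generated: the orthogonality of the
remaining products follows ([frame_orth]). *)
Record cayley_triple x y z : Prop := CayleyTriple {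
  triple_imag : [/\ imag x, imag y & imag z];
  triple_orth : [/\ B x y = 0, B x z = 0, B y z = 0 & B (x ** y) z = 0];
  triple_anis : [/\ q x != 0, q y != 0 & q z != 0]
}.

(** Positions 0 to 7 are chosen so that the product of the elements in positions
i and j is a multiple of the one in position i xor j. *)
Definition frame x y z : seq O :=
  [:: '1o; x; y; x ** y; z; x ** z; y ** z; x ** y ** z].

Definition frame_norms (a b c : k) : seq k :=
  [:: 1; a; b; a * b; c; a * c; b * c; a * b * c].

(** Structure constants of [frame] in terms of the norms a, b, c of the three
generators; row i lists the products with the i-th element on the left. *)
Definition frame_coefs (a b c : k) : seq (seq k) :=
  [:: [:: 1; 1; 1; 1; 1; 1; 1; 1];
      [:: 1; - a; 1; - a; 1; - a; -1; a];
      [:: 1; -1; - b; b; 1; 1; - b; - b];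
      [:: 1; a; - b; - (a * b); 1; - a; b; - (a * b)];
      [:: 1; -1; -1; -1; - c; c; c; c];
      [:: 1; a; -1; a; - c; - (a * c); - c; a * c];
      [:: 1; 1; b; - b; - c; c; - (b * c); - (b * c)];
      [:: 1; - a; b; a * b; - c; - (a * c); b * c; - (a * b * c)]].

(** The table of the bitwise exclusive or, in a form that reduces on numerals. *)
Definition frame_index : seq (seq nat) :=
  [:: [:: 0; 1; 2; 3; 4; 5; 6; 7]; [:: 1; 0; 3; 2; 5; 4; 7; 6];
      [:: 2; 3; 0; 1; 6; 7; 4; 5]; [:: 3; 2; 1; 0; 7; 6; 5; 4];
      [:: 4; 5; 6; 7; 0; 1; 2; 3]; [:: 5; 4; 7; 6; 1; 0; 3; 2];
      [:: 6; 7; 4; 5; 2; 3; 0; 1]; [:: 7; 6; 5; 4; 3; 2; 1; 0]]%N.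

Lemma anticomm u v : imag u -> imag v -> B u v = 0 -> u ** v = - (v ** u).
Proof.
move=> iu iv uv; apply/eqP; rewrite -addr_eq0 imag_anticomm // uv mulr0.
by rewrite scale0r.
Qed.

Lemma anticommM u v x : imag u -> imag v -> B u v = 0 ->
  u ** (v ** x) = - (v ** (u ** x)).
Proof.
move=> iu iv uv; apply/eqP; rewrite -addr_eq0 clifford_mul // uv mulr0.
by rewrite scale0r.
Qed.

Lemma imag_sqr u : imag u -> u ** u = - q u *: '1o.
Proof. by move=> iu; have := imag_mul2 hk2 '1o iu; rewrite !octM1. Qed.

Lemma mul_imag u v : imag u -> imag v -> B u v = 0 -> imag (u ** v).
Proof. by move=> iu iv uv; rewrite /imag octB_mul1 // uv oppr0. Qed.

Section Triple.

Variables (x y z : O) (xyz : cayley_triple x y z).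
Local Notation e := (nth 0 (frame x y z)).
Local Notation n := (nth 0 (frame_norms (q x) (q y) (q z))).
Local Notation c := (fun i j => nth 0 (nth [::] (frame_coefs (q x) (q y) (q z)) i) j).

Lemma frame_imag i : (0 < i < 8)%N -> imag (e i).
Proof.
have [[ix iy iz] [xy xz yz xyz0] _] := xyz.
by do 8?[case: i => [|i]] => //= _; do ?apply: mul_imag.
Qed.

Lemma frame_normE i : q (e i) = n i.
Proof.
case: (ltnP i 8) => i8; last first.
  by rewrite !nth_default // -octBE // octB0l.
by move: i8; do 8?[case: i => [|i]] => //= _; rewrite ?oct_normM ?oct_norm1.
Qed.

Lemma frame_norm_neq0 i : (i < 8)%N -> n i != 0.
Proof.
have [_ _ [nx ny nz]] := xyz.
by do 8?[case: i => [|i]] => //= _; rewrite ?oner_eq0 ?mulf_neq0.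
Qed.

(** Besides the hypotheses, the only ingredients are that multiplication by an
element is a similitude and, for an imaginary one, skew. *)
Lemma frame_orth i j : (i < 8)%N -> (j < 8)%N -> i != j -> B (e i) (e j) = 0.
Proof.
have [[ix iy iz] [xy xz yz xyz0] _] := xyz.
have im l : _ := frame_imag (i := l).
have i3 := im 3%N isT; have i5 := im 5%N isT; have i6 := im 6%N isT.
have {im} i7 := im 7%N isT; rewrite /= in i3 i5 i6 i7.
have Bu_uv u v : imag v -> B u (u ** v) = 0.
  by move=> iv; rewrite -{1}[u]octM1 octB_mull octBC iv mulr0.
have Bv_uv u v : imag u -> B v (u ** v) = 0.
  by move=> iu; rewrite -{1}[v]oct1M octB_mulr octBC iu mul0r.
have o15 := Bu_uv x z iz; have o13 := Bu_uv x y iy; have o26 := Bu_uv y z iz.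
have o37 := Bu_uv (x ** y) z iz; have o47 := Bv_uv (x ** y) z i3.
have o23 := Bv_uv x y ix; have o45 := Bv_uv x z ix; have o46 := Bv_uv y z iy.
have o25 : B y (x ** z) = 0 by rewrite octBC octB_skewl // octBC xyz0 oppr0.
have o16 : B x (y ** z) = 0.
  by rewrite octBC octB_skewl // anticomm ?octBNr ?(octBC z) ?xyz0 ?oppr0 // octBC.
have o35 : B (x ** y) (x ** z) = 0 by rewrite octB_mull yz mulr0.
have o36 : B (x ** y) (y ** z) = 0.
  by rewrite anticomm // octBNl octB_mull xz mulr0 oppr0.
have o56 : B (x ** z) (y ** z) = 0 by rewrite octB_mulr xy mul0r.
have o57 : B (x ** z) (x ** y ** z) = 0 by rewrite octB_mulr o13 mul0r.
have o67 : B (y ** z) (x ** y ** z) = 0 by rewrite octB_mulr o23 mul0r.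
have o17 : B x (x ** y ** z) = 0 by rewrite octBC octB_skewr // o35 oppr0.
have o27 : B y (x ** y ** z) = 0 by rewrite octBC octB_skewr // o36 oppr0.
wlog ij : i j / (i < j)%N => [W i8 j8 nij|_ j8 _].
  by case: (ltngtP i j) nij => // h _; [|rewrite octBC]; apply: W; rewrite // neq_ltn h.
case: i ij => [|i] ij; first by rewrite octBC; apply: frame_imag; rewrite ij.
by move: j8 ij; do 8?[case: j => [|j]] => //= _; do 7?[case: i => [|i]].
Qed.

Local Notation m i j := (nth 0%N (nth [::] frame_index i) j).

(** The table is obtained by moving generators with the Clifford relations
between orthogonal imaginary elements. *)
Lemma frame_mul i j : (i < 8)%N -> (j < 8)%N -> e i ** e j = c i j *: e (m i j).
Proof.
have im l : _ := frame_imag (i := l).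
have sw l r : (0 < l < 8)%N -> (0 < r < 8)%N -> l != r ->
    e l ** e r = - (e r ** e l).
  move=> hl hr lr; apply: anticomm; try exact: frame_imag.
  by apply: frame_orth; [case/andP: hl | case/andP: hr|].
have swM l r w : (0 < l < 8)%N -> (0 < r < 8)%N -> l != r ->
    e l ** (e r ** w) = - (e r ** (e l ** w)).
  move=> hl hr lr; apply: anticommM; try exact: frame_imag.
  by apply: frame_orth; [case/andP: hl | case/andP: hr|].
have sq l w : (0 < l < 8)%N -> e l ** (e l ** w) = - n l *: w.
  by move=> hl; rewrite imag_mul2 ?frame_normE //; apply: im.
have sq1 l : (0 < l < 8)%N -> e l ** e l = - n l *: '1o.
  by move=> hl; rewrite imag_sqr ?frame_normE //; apply: im.
pose lin := (octMNl, octMNr, octMZl, octMZr, scaleNr, scalerA, scalerN, mulrN, opprK).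
(* x (y z) is the one product of generators where non-associativity shows. *)
have m16 : e 1%N ** e 6%N = - e 7%N.
  by rewrite [e 6%N](sw 2%N 4%N) // lin (swM 1%N 4%N) // opprK (sw 4%N 3%N).
have m25 : e 2%N ** e 5%N = e 7%N.
  by rewrite (swM 2%N 1%N) // m16 opprK.
have m13 : e 1%N ** e 3%N = - q x *: e 2%N by rewrite (sq 1%N) ?lin.
have m15 : e 1%N ** e 5%N = - q x *: e 4%N by rewrite (sq 1%N) ?lin.
have m17 : e 1%N ** e 7%N = q x *: e 6%N.
  by rewrite -[e 7%N]opprK -m16 !lin (sq 1%N) // !lin.
have m23 : e 2%N ** e 3%N = q y *: e 1%N.
  by rewrite [e 3%N](sw 1%N 2%N) // !lin (sq 2%N) // !lin.
have m26 : e 2%N ** e 6%N = - q y *: e 4%N by rewrite (sq 2%N) ?lin.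
have m27 : e 2%N ** e 7%N = - q y *: e 5%N by rewrite -m25 (sq 2%N) ?lin.
have m35 : e 3%N ** e 5%N = - q x *: e 6%N.
  by rewrite (swM 3%N 1%N) // m17 !lin.
have m36 : e 3%N ** e 6%N = q y *: e 5%N.
  by rewrite (swM 3%N 2%N) // m27 !lin.
have m37 : e 3%N ** e 7%N = - (q x * q y) *: e 4%N by rewrite (sq 3%N) ?lin.
have m45 : e 4%N ** e 5%N = q z *: e 1%N.
  by rewrite [e 5%N](sw 1%N 4%N) // !lin (sq 4%N) // !lin.
have m46 : e 4%N ** e 6%N = q z *: e 2%N.
  by rewrite [e 6%N](sw 2%N 4%N) // !lin (sq 4%N) // !lin.
have m47 : e 4%N ** e 7%N = q z *: e 3%N.
  by rewrite [e 7%N](sw 3%N 4%N) // !lin (sq 4%N) // !lin.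
have m56 : e 5%N ** e 6%N = - q z *: e 3%N.
  by rewrite (swM 5%N 2%N) // (sw 5%N 4%N) // m45 !lin (sw 2%N 1%N) // !lin.
have m57 : e 5%N ** e 7%N = (q x * q z) *: e 2%N.
  by rewrite (swM 5%N 3%N) // (sw 5%N 4%N) // m45 !lin (sw 3%N 1%N) // m13 !lin mulrC.
have m67 : e 6%N ** e 7%N = - (q y * q z) *: e 1%N.
  by rewrite (swM 6%N 3%N) // (sw 6%N 4%N) // m46 !lin (sw 3%N 2%N) // m23 !lin mulrC.
move: m13 m15 m16 m17 m23 m25 m26 m27 m35 m36 m37 m45 m46 m47 m56 m57 m67 => /=.
move=> m13 m15 m16 m17 m23 m25 m26 m27 m35 m36 m37 m45 m46 m47 m56 m57 m67.
have lt l r : (0 < l)%N -> (l < r)%N -> (r < 8)%N ->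
    e l ** e r = c l r *: e (m l r).
  do 8?[case: l => [|l]] => //=; do 8?[case: r => [|r]] => //= _ _ _;
    by rewrite ?scale1r ?scaleN1r // ?m13 ?m15 ?m16 ?m17 ?m23 ?m25 ?m26 ?m27 ?m35
      ?m36 ?m37 ?m45 ?m46 ?m47 ?m56 ?m57 ?m67 // ?scale1r ?scaleN1r.
move=> hi hj; have [->|i0] := posnP i.
  by move: hj; do 8?[case: j => [|j]] => //= _; rewrite oct1M scale1r.
have [->|j0] := posnP j.
  by move: i0 hi; do 8?[case: i => [|i]] => //= _ _; rewrite octM1 scale1r.
case: (ltngtP i j) => [ij|ij|->]; first exact: lt.
  rewrite sw ?i0 ?j0 ?neq_ltn ?ij ?orbT // lt // -scaleNr.
  move: i0 j0 ij hi {hj}; do 8?[case: i => [|i]] => //=; do 8?[case: j => [|j]] => //= _ _ _ _;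
    by rewrite ?opprK.
rewrite sq1 ?j0 //.
by move: j0 hj; do 8?[case: j => [|j]].
Qed.

Lemma frame_orthogonal : orthogonal_seq (frame x y z).
Proof.
apply/andP; split; last first.
  by apply/(all_nthP 0) => i i8; rewrite frame_normE frame_norm_neq0.
apply/(pairwiseP 0) => i j; rewrite !inE => i8 j8 ij.
by rewrite frame_orth ?neq_ltn ?ij.
Qed.

Lemma frame_expand w : w = \sum_(i < 8) (B w (e i) / n i) *: e i.
Proof.
rewrite {1}[w](orthogonal_expand hk2 w frame_orthogonal) // (big_nth 0) big_mkord.
by apply: eq_bigr => i _; rewrite frame_normE.
Qed.

Lemma frame_expand_imag w : imag w ->
  w = \sum_(i < 7) (B w (e i.+1) / n i.+1) *: e i.+1.
Proof.
move=> iw; rewrite {1}[w]frame_expand big_ord_recl /= -/'1o iw mul0r scale0r.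
by rewrite add0r.
Qed.

End Triple.

Lemma imag_anisotropic : exists2 x, imag x & q x != 0.
Proof.
have [||x [ox qx]] := @orthogonal_extend _ hk2 O [:: '1o].
- by rewrite /orthogonal_seq /= oct_norm1 // oner_eq0.
- by [].
by exists x => //; apply: ox; rewrite inE.
Qed.

(** The Cayley-Dickson process. *)
Lemma cayley_triple_extend x : imag x -> q x != 0 ->
  exists y z, cayley_triple x y z.
Proof.
move=> ix qx.
have [||y [oy qy]] := @orthogonal_extend _ hk2 O [:: '1o; x].
- rewrite /orthogonal_seq /= oct_norm1 // oner_eq0 qx octBC ix eqxx //.
- by [].
have iy : imag y by apply: oy; rewrite inE eqxx.
have yx : B y x = 0 by apply: oy; rewrite !inE eqxx orbT.
have xy : B x y = 0 by rewrite octBC.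
have i3 := mul_imag ix iy xy.
have [||z [oz qz]] := @orthogonal_extend _ hk2 O [:: '1o; x; y; x ** y].
- rewrite /orthogonal_seq /= oct_norm1 // oner_eq0 qx qy oct_normM // mulf_neq0 //.
  have -> : B x (x ** y) = 0 by rewrite -{1}[x]octM1 octB_mull // octBC iy mulr0.
  have -> : B y (x ** y) = 0 by rewrite -{1}[y]oct1M octB_mulr // octBC ix mul0r.
  by rewrite !(octBC '1o) ix iy i3 xy eqxx.
- by [].
have o w : w \in [:: '1o; x; y; x ** y] -> B w z = 0 by move=> /oz; rewrite octBC.
exists y, z; split; split=> //; first by apply: oz; rewrite inE eqxx.
all: by apply: o; rewrite !inE eqxx ?orbT.
Qed.

End CayleyFrame.

(** * Commutators in the Clifford algebra *)

Section CliffordAction.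

Variables (k : fieldType) (hk2 : (2 \notin [pchar k])%N) (O : octonionAlg k).
Local Notation B := (@octB k O).
Local Notation V := (imO O).
Variables (C : algType k) (io : {linear V -> C}).
Hypothesis hC : is_clifford_algebra (fun u : V => - imq u) io.
Local Notation bracket x y := (x * y - y * x).

Lemma imBE (u v : V) : imB u v = B (vsval u) (vsval v). Proof. by []. Qed.
Lemma imBDl (w u v : V) : imB (u + v) w = imB u w + imB v w.
Proof. by rewrite !imBE linearD octBDl. Qed.
Lemma imBZl a (w u : V) : imB (a *: u) w = a * imB u w.
Proof. by rewrite !imBE linearZ octBZl. Qed.
Lemma imBC (u v : V) : imB u v = imB v u. Proof. exact: octBC. Qed.
Lemma imB_suml I (r : seq I) (P : pred I) (f : I -> V) (w : V) :
  imB (\sum_(i <- r | P i) f i) w = \sum_(i <- r | P i) imB (f i) w.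
Proof. by rewrite imBE linear_sum linear_sumlz. Qed.
Lemma imB_sumr I (r : seq I) (P : pred I) (f : I -> V) (w : V) :
  imB w (\sum_(i <- r | P i) f i) = \sum_(i <- r | P i) imB w (f i).
Proof. by rewrite imBE linear_sum linear_sumr. Qed.

Lemma iota_anticomm u v : io u * io v + io v * io u = (- 2%:R * imB u v)%:A.
Proof.
have sqr w := clifford_sqr hC w.
have := sqr (u + v); rewrite linearD mulrDl !mulrDr !sqr /imq -!octBE // linearD.
rewrite octBDl !octBDr (octBC (vsval v)) => h.
apply: (addrI ((- B (vsval u) (vsval u))%:A + (- B (vsval v) (vsval v))%:A)).
transitivity ((- B (vsval u) (vsval u))%:A + io u * io v + (io v * io u
   + (- B (vsval v) (vsval v))%:A)); first by rewrite -!addrA; congr +%R; rewrite addrC !addrA.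
by rewrite h -!scalerDl imBE; congr (_ *: _); ring.
Qed.

(** The commutator with a bivector acts on vectors as an infinitesimal rotation.
Each of the two products in the bracket of u and v contributes 2, from
uw + wu = - 2 B(u,w). *)
Lemma bracket_iota2 u v w : bracket (bracket (io u) (io v)) (io w) =
  io ((4%:R * imB u w) *: v - (4%:R * imB v w) *: u).
Proof.
have ac a b : io a * io b = (- 2%:R * imB a b)%:A - io b * io a.
  by rewrite -iota_anticomm addrK.
have -> r s : io (r *: v - s *: u) = r *: io v - s *: io u.
  by rewrite linearB !linearZ.
set r := 4%:R * _; set s := 4%:R * _.
rewrite !mulrBl !mulrBr !mulrA.
have -> : io u * io v * io w =
    (- 2%:R * imB v w) *: io u + (2%:R * imB u w) *: io v + io w * io u * io v.
  rewrite -(mulrA (io u)) (ac v w) mulrBr (mulrA (io u)) (ac u w) mulrBl -scalerAr -scalerAl mulr1 mul1r.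
  by rewrite opprB [X in _ + X]addrC -scaleNr -mulNr opprK addrA.
have -> : io v * io u * io w =
    (- 2%:R * imB u w) *: io v + (2%:R * imB v w) *: io u + io w * io v * io u.
  rewrite -(mulrA (io v)) (ac u w) mulrBr (mulrA (io v)) (ac v w) mulrBl -scalerAr -scalerAl mulr1 mul1r.
  by rewrite opprB [X in _ + X]addrC -scaleNr -mulNr opprK addrA.
set P := io w * io u * io v; set Q := io w * io v * io u.
rewrite [- (_ + Q)]opprD addrACA addrK.
rewrite [X in X - _]addrC [- (_ *: _ + _)]opprD addrACA -!scalerBl -(scaleNr s).
by congr (_ *: _ + _ *: _); rewrite /r /s; ring.
Qed.

(** The last clause recovers x from the rotation delta that it induces: expanding
each vector of each bracket on an orthogonal basis, both of its terms
contribute - 4 times the bracket.  It yields injectivity on C^2 of the spin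
representation with no recourse to a basis of the Clifford algebra. *)
Lemma clifford2_vector x : in_clifford2 io x ->
  exists delta : V -> V,
  [/\ forall w, bracket x (io w) = io (delta w),
      forall w z, imB (delta w) z = - imB w (delta z) &
      forall m (e : 'I_m -> V) (n : 'I_m -> k),
        (forall w, w = \sum_i (imB w (e i) / n i) *: e i) ->
        \sum_i (n i)^-1 *: bracket (io (delta (e i))) (io (e i)) = - 8%:R *: x].
Proof.
case=> N [c [u [v ->]]].
exists (fun w => \sum_i c i *: ((4%:R * imB (u i) w) *: v i - (4%:R * imB (v i) w) *: u i)).
split=> [w|w z|m e n he].
- rewrite mulr_suml mulr_sumr -sumrB linear_sum; apply: eq_bigr => i _.
  by rewrite linearZ /= -bracket_iota2 -scalerAl -scalerAr -scalerBr.
- rewrite imB_suml imB_sumr -sumrN; apply: eq_bigr => i _.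
  rewrite -scaleNr !(imBC w) !imBZl !imBDl -!scaleNr !imBZl !(imBC _ w) !(imBC _ z).
  by ring.
transitivity (\sum_(j < N) c j *: ((- 8%:R) *: bracket (io (u j)) (io (v j)))); last first.
  by rewrite scaler_sumr; apply: eq_bigr => j _; rewrite !scalerA mulrC.
pose T (j : 'I_N) i := c j *: ((4%:R * (imB (u j) (e i) / n i)) *: bracket (io (v j)) (io (e i))
   - (4%:R * (imB (v j) (e i) / n i)) *: bracket (io (u j)) (io (e i))).
transitivity (\sum_i \sum_j T j i).
  apply: eq_bigr => i _; rewrite linear_sum mulr_suml mulr_sumr -sumrB scaler_sumr.
  apply: eq_bigr => j _; rewrite /T.
  set a := 4%:R * imB (u j) (e i); set b := 4%:R * imB (v j) (e i).
  have -> : io (c j *: (a *: v j - b *: u j)) =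
      c j *: (a *: io (v j) - b *: io (u j)) by rewrite linearZ linearB !linearZ.
  rewrite -scalerAl -scalerAr -scalerBr [LHS]scalerA [_^-1 * _]mulrC -[LHS]scalerA.
  congr (_ *: _).
  rewrite mulrBl mulrBr -!scalerAl -!scalerAr [- (_ *: _ - _)]opprD addrACA -opprD.
  rewrite -!scalerBr [LHS]scalerBr !scalerA ![(n i)^-1 * _]mulrC.
  by congr (_ *: _ - _ *: _); rewrite mulrA.
rewrite exchange_big; apply: eq_bigr => j _; rewrite -scaler_sumr; congr (_ *: _).
have S a b : \sum_i (4%:R * (imB a (e i) / n i)) *: bracket (io b) (io (e i)) =
    4%:R *: bracket (io b) (io a).
  rewrite [in RHS](he a) linear_sum mulr_sumr mulr_suml -sumrB scaler_sumr.
  by apply: eq_bigr => i _; rewrite linearZ /= -scalerAl -scalerAr -scalerBr scalerA.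
rewrite sumrB !S -[bracket (io (v j)) _]opprB scalerN -opprD -scalerDl scaleNr.
by congr (- (_ *: _)); ring.
Qed.

End CliffordAction.

(** * Traces of left multiplications *)

Section Trace.
Variables (k : fieldType).
Local Notation tr := (@lfun_trace _ _).
Import passmx.

Lemma lfun_traceC (V W : vectType k) (f : 'Hom(V, W)) (g : 'Hom(W, V)) :
  tr (f \o g)%VF = tr (g \o f)%VF.
Proof.
rewrite /lfun_trace.
rewrite (mxof_comp _ _ (vbasisP {:V})) (mxof_comp _ _ (vbasisP {:W})).
exact: mxtrace_mulC.
Qed.

Lemma lfun_traceD (V : vectType k) (f g : 'End(V)) : tr (f + g) = tr f + tr g.
Proof. by rewrite /lfun_trace linearD mxtraceD. Qed.
Lemma lfun_traceZ (V : vectType k) a (f : 'End(V)) : tr (a *: f) = a * tr f.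
Proof. by rewrite /lfun_trace linearZ mxtraceZ. Qed.
Lemma lfun_traceN (V : vectType k) (f : 'End(V)) : tr (- f) = - tr f.
Proof. by rewrite -scaleN1r lfun_traceZ mulN1r. Qed.
Lemma lfun_trace_sum (V : vectType k) I (r : seq I) (P : pred I) (f : I -> 'End(V)) :
  tr (\sum_(i <- r | P i) f i) = \sum_(i <- r | P i) tr (f i).
Proof.
apply: (big_morph (@lfun_trace _ _)) => [g h|]; first exact: lfun_traceD.
by rewrite -(scale0r 0) lfun_traceZ mul0r.
Qed.

Lemma lfun_trace1 (V : vectType k) : tr (\1 : 'End(V))%VF = (\dim {:V})%:R.
Proof. by rewrite /lfun_trace mxof1 ?mxtrace1 // (basis_free (vbasisP _)). Qed.

End Trace.

Section LeftMultiplicationTraces.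

Variables (k : fieldType) (hk2 : (2 \notin [pchar k])%N) (O : octonionAlg k).
Local Notation B := (@octB k O).
Local Notation q := (@oct_norm k O).
Local Notation L := (@oct_lmul k O).
Local Notation tr := (@lfun_trace _ _).

Lemma lmulE (u x : O) : L u x = u ** x. Proof. exact: lfunE. Qed.
Lemma lmulD (u v : O) : L (u + v) = L u + L v.
Proof. by apply/lfunP => y; rewrite add_lfunE !lmulE octMDl. Qed.
Lemma lmulZ a (u : O) : L (a *: u) = a *: L u.
Proof. by apply/lfunP => y; rewrite scale_lfunE !lmulE octMZl. Qed.

Lemma lmul_clifford u v : imag u -> imag v ->
  ((L u \o L v) + (L v \o L u))%VF = (- 2%:R * B u v) *: (\1)%VF.
Proof.
move=> iu iv; apply/lfunP => y.
by rewrite add_lfunE !comp_lfunE !lmulE clifford_mul // scale_lfunE id_lfunE.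
Qed.

Lemma trace_lmul2 u v : imag u -> imag v -> tr (L u \o L v)%VF = - 8%:R * B u v.
Proof.
move=> iu iv; have := congr1 tr (lmul_clifford iu iv).
rewrite lfun_traceD lfun_traceZ lfun_trace1 oct_dim (lfun_traceC (L v)) => h.
apply: (mulfI (two_neq0 hk2)); apply: (eq_lincomb (c := 1) h); ring.
Qed.

(** Conjugation by L_d changes the sign of each of the three factors, hence of
the trace. *)
Lemma trace_lmul3_orth d u v w : imag d -> q d != 0 -> imag u -> imag v -> imag w ->
  B d u = 0 -> B d v = 0 -> B d w = 0 -> tr (L u \o (L v \o L w))%VF = 0.
Proof.
move=> id qd iu iv iw du dv dw; set T := (L u \o _)%VF.
have sq : (L d \o L d)%VF = - q d *: \1%VF.
  by apply/lfunP => y; rewrite comp_lfunE !lmulE imag_mul2 // scale_lfunE id_lfunE.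
have Td : (L d \o T)%VF = - (T \o L d)%VF.
  apply/lfunP => y; rewrite opp_lfunE !comp_lfunE !lmulE.
  rewrite (anticommM hk2 _ id iu) // (anticommM hk2 _ id iv) // (anticommM hk2 _ id iw) //.
  by rewrite !octMNr opprK.
have : tr (T \o (L d \o L d))%VF = tr (L d \o T \o L d)%VF.
  by rewrite comp_lfunA lfun_traceC comp_lfunA.
rewrite Td sq comp_lfunNl lfun_traceN -comp_lfunA sq -comp_lfunZr comp_lfun1r.
rewrite lfun_traceZ => h; apply: (mulfI qd); apply: (mulfI (two_neq0 hk2)).
by apply: (eq_lincomb (c := -1) h); ring.
Qed.

Lemma imag_linear_eq0 x y z (xyz : cayley_triple x y z) (f : O -> k) :
  (forall a u v, f (a *: u + v) = a * f u + f v) ->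
  (forall i, (0 < i < 8)%N -> f (nth 0 (frame x y z) i) = 0) ->
  forall u, imag u -> f u = 0.
Proof.
move=> flin fe u iu; rewrite (frame_expand_imag hk2 xyz iu).
have f0 : f 0 = 0.
  by have := flin (-1) 0 0; rewrite scaler0 addr0 mulN1r addNr.
elim/big_rec: _ => // i v _ fv.
by rewrite flin fv addr0 fe ?mulr0 //= ltnS ltn_ord.
Qed.

(** By trilinearity the three vectors may be taken in a frame, whose seven
imaginary elements leave room for a fourth one orthogonal to all of them. *)
Lemma trace_lmul3 u v w : imag u -> imag v -> imag w ->
  tr (L u \o (L v \o L w))%VF = 0.
Proof.
have [x ix qx] := imag_anisotropic hk2 O.
have [y [z xyz]] := cayley_triple_extend hk2 ix qx.
have ei := frame_imag hk2 xyz; set e := nth 0 (frame x y z) in ei.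
have lin3 a (b c d d' : O) : tr (L b \o (L c \o L (a *: d + d')))%VF =
    a * tr (L b \o (L c \o L d))%VF + tr (L b \o (L c \o L d'))%VF.
  by rewrite lmulD lmulZ !comp_lfunDr -!comp_lfunZr lfun_traceD lfun_traceZ.
have cyc (a b c : O) : tr (L a \o (L b \o L c))%VF = tr (L b \o (L c \o L a))%VF.
  by rewrite lfun_traceC comp_lfunA.
move=> iu iv iw.
apply: (imag_linear_eq0 (f := fun w => tr (L u \o (L v \o L w))%VF) xyz _ _ iw)
  => // l hl; rewrite -/e -cyc.
apply: (imag_linear_eq0 (f := fun w => tr (L (e l) \o (L u \o L w))%VF) xyz _ _ iv)
  => // j hj; rewrite -/e -cyc.
apply: (imag_linear_eq0 (f := fun w => tr (L (e j) \o (L (e l) \o L w))%VF) xyz _ _ iu)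
  => // i hi; rewrite -/e.
have [d /andP[d0 d8] [di dj dl]] : exists2 d, (0 < d < 8)%N & [/\ d != i, d != j & d != l].
  have /hasP[d] : has (fun d => d \notin [:: i; j; l]) (iota 1 7).
    rewrite has_predC; apply/negP => /allP sub.
    by have := uniq_leq_size (iota_uniq 1 7) sub.
  by rewrite mem_iota !inE !negb_or => hd /and3P[di dj dl]; exists d.
have fr := frame_orth hk2 xyz.
move: (hi) (hj) (hl) => /andP[_ i8] /andP[_ j8] /andP[_ l8].
apply: (@trace_lmul3_orth (e d)); rewrite ?fr ?frame_normE //.
all: try (apply: ei => //; by rewrite d0).
exact: frame_norm_neq0.
Qed.

End LeftMultiplicationTraces.

(** * Elements of g as derivations *)

Section G2Action.

Variables (k : fieldType) (hk2 : (2 \notin [pchar k])%N) (O : octonionAlg k).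
Local Notation B := (@octB k O).
Local Notation L := (@oct_lmul k O).
Local Notation tr := (@lfun_trace _ _).
Local Notation V := (imO O).
Variables (C : algType k) (io : {linear V -> C}).
Hypothesis hC : is_clifford_algebra (fun u : V => - imq u) io.
Variables (rho : {linear C -> 'End(O)}) (hrho : is_clifford_action io rho).
Local Notation bracket x y := (x * y - y * x).
Local Notation in_g2 := (in_g2 io rho).

Lemma rho_bracket u v : rho (bracket (io u) (io v)) =
  (L (vsval u) \o L (vsval v))%VF - (L (vsval v) \o L (vsval u))%VF.
Proof. by rewrite linearB !(actionM hrho) !(action_iota hrho). Qed.

(** Evaluating [rho(x), L_w] = L_(delta w) at the unit, which rho(x) kills,
identifies delta with rho(x) on imaginary elements. *)
Lemma g2_vector x : in_g2 x ->
  [/\ forall w : V, imag (rho x (vsval w)),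
      forall w z : V, B (rho x (vsval w)) (vsval z) = - B (vsval w) (rho x (vsval z)),
      forall w : V, (rho x \o L (vsval w) = (L (vsval w) \o rho x) + L (rho x (vsval w)))%VF &
      forall (w : V), vsval (rho_im rho x w) = rho x (vsval w)].
Proof.
case=> cx x1; have [d [dE dskew _]] := clifford2_vector hk2 hC cx.
have comm w : (rho x \o L (vsval w) - (L (vsval w) \o rho x) = L (vsval (d w)))%VF.
  by have := congr1 rho (dE w); rewrite linearB !(actionM hrho) !(action_iota hrho).
have act w : rho x (vsval w) = vsval (d w).
  have := congr1 (fun f : 'End(O) => f '1o) (comm w).
  rewrite /= add_lfunE opp_lfunE !comp_lfunE !lmulE !octM1 x1.
  by rewrite octM0r subr0.
split=> [w|w z|w|w]; rewrite ?act; first exact: imag_val.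
- by have := dskew w z; rewrite /imB.
- by rewrite -comm addrC subrK.
by rewrite /rho_im !comp_lfunE !lfunE /= act vsvalK.
Qed.

Lemma g2_derivation x (u : V) (y : O) : in_g2 x ->
  rho x (vsval u ** y) = rho x (vsval u) ** y + vsval u ** rho x y.
Proof.
case/g2_vector=> _ _ /(_ u) /(congr1 (fun f : 'End(O) => f y)) + _.
by rewrite add_lfunE !comp_lfunE !lmulE addrC.
Qed.

Lemma imag_ex x : imag x -> exists u : V, vsval u = x.
Proof. by move=> /(imag_spaceP hk2) ix; exists (vsproj _ x); rewrite vsprojK. Qed.

Lemma g2_imag x y : in_g2 x -> imag (rho x y).
Proof.
move=> gx; have [+ _ _ _] := g2_vector gx; case: gx => _ x1.
have [u yE] := imag_ex (imag_proj hk2 y) => /(_ u); rewrite yE.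
by rewrite linearB linearZ /= x1 scaler0 subr0.
Qed.

(** The image of rho(y) is imaginary for y in g, so by cyclicity the trace does
not see which complement of the imaginary part the projection uses. *)
Lemma trace_rho_im x y : in_g2 x -> in_g2 y ->
  tr (rho_im rho x \o rho_im rho y)%VF = tr (rho x \o rho y)%VF.
Proof.
move=> gx gy; rewrite /rho_im; set p := linfun (vsproj _); set i := linfun vsval.
have pi z : in_g2 z -> (i \o (p \o rho z) = rho z)%VF.
  move=> gz; apply/lfunP => w; rewrite !comp_lfunE !lfunE /= vsprojK //.
  exact/(imag_spaceP hk2)/g2_imag.
rewrite -!comp_lfunA (comp_lfunA p (rho y)) (comp_lfunA i) pi // lfun_traceC.
rewrite -!comp_lfunA (comp_lfunA (rho x)) lfun_traceC -comp_lfunA.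
by rewrite (comp_lfunA p) (comp_lfunA i) pi.
Qed.

(** Cyclicity replaces [L_u, L_v] rho(y) by L_u [L_v, rho(y)], and the inner
commutator is - L_(rho(y) v). *)
Lemma trace_bracket y (u v : V) : in_g2 y ->
  tr (((L (vsval u) \o L (vsval v)) - (L (vsval v) \o L (vsval u))) \o rho y)%VF =
  - 8%:R * B (rho y (vsval u)) (vsval v).
Proof.
move=> gy; have [iy skew comm _] := g2_vector gy.
rewrite comp_lfunDl comp_lfunNl lfun_traceD lfun_traceN.
rewrite -!comp_lfunA [X in _ - X]lfun_traceC -comp_lfunA comm.
rewrite comp_lfunDr lfun_traceD opprD addrA addrN add0r.
by rewrite trace_lmul2 ?skew //; [ring | exact: imag_val].
Qed.

Lemma trace_g2_lmul y u : in_g2 y -> imag u -> tr (rho y \o L u)%VF = 0.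
Proof.
case=> -[n [c [v [w ->]]]] _ iu; rewrite linear_sum /=.
rewrite (big_morph (fun f => f \o L u)%VF (fun f g => comp_lfunDl f g (L u)) (comp_lfun0l _ (L u))).
rewrite lfun_trace_sum big1 // => i _.
rewrite linearZ /= rho_bracket -comp_lfunZl lfun_traceZ comp_lfunDl comp_lfunNl.
rewrite lfun_traceD lfun_traceN -!comp_lfunA !trace_lmul3 //; try exact: imag_val.
by rewrite subrr mulr0.
Qed.

(** Right multiplication by an imaginary element, expressed by conjugation so
that its trace against rho(g) follows from that of left multiplication. *)
Definition oct_rmul (u : O) : 'End(O) :=
  - (linfun (@oct_conj k O) \o (L u \o linfun (@oct_conj k O)))%VF.
Local Notation R := oct_rmul.

Lemma rmulE u y : imag u -> R u y = y ** u.
Proof.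
move=> iu; rewrite opp_lfunE !comp_lfunE !lfunE /= oct_conjM // oct_conjK //.
by rewrite conj_imag // octMNr opprK.
Qed.

Lemma rmulP a u v : R (a *: u + v) = a *: R u + R v.
Proof.
rewrite /R lmulD lmulZ comp_lfunDl comp_lfunDr opprD; congr (_ + _).
by rewrite -comp_lfunZl -comp_lfunZr scalerN.
Qed.

Lemma trace_g2_rmul y u : in_g2 y -> imag u -> tr (rho y \o R u)%VF = 0.
Proof.
move=> gy iu; rewrite /R comp_lfunNr lfun_traceN; set K := linfun _.
have KK : (K \o K = \1)%VF.
  by apply/lfunP => z; rewrite comp_lfunE id_lfunE !lfunE /= oct_conjK.
have yK : (rho y \o K = K \o rho y)%VF.
  apply/lfunP => z; rewrite !comp_lfunE !lfunE /= [in RHS]conj_imag //; last exact: g2_imag.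
  by rewrite /oct_conj linearB linearZ /= gy.2 scaler0 sub0r.
rewrite comp_lfunA yK -comp_lfunA lfun_traceC -!comp_lfunA KK comp_lfun1r.
by rewrite trace_g2_lmul ?oppr0.
Qed.

Lemma clifford2_lincomb a x y : in_clifford2 io x -> in_clifford2 io y ->
  in_clifford2 io (a *: x + y).
Proof.
case=> [n [c [u [v ->]]]] [m [d [s [t ->]]]].
pose cat T (f : 'I_n -> T) (g : 'I_m -> T) (i : 'I_(n + m)) :=
  match split i with inl j => f j | inr j => g j end.
exists (n + m)%N, (cat k (fun i => a * c i) d), (cat V u s), (cat V v t).
rewrite big_split_ord scaler_sumr /=; congr (_ + _); apply: eq_bigr => i _.
  by rewrite /cat (unsplitK (inl i : 'I_n + 'I_m)) scalerA.
by rewrite /cat (unsplitK (inr i : 'I_n + 'I_m)).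
Qed.

Lemma clifford2_0 : in_clifford2 io 0.
Proof.
exists 0%N, (fun=> 0), (fun=> 0), (fun=> 0); by rewrite big_ord0.
Qed.

Lemma clifford2_bracket u v : in_clifford2 io (bracket (io u) (io v)).
Proof.
by exists 1%N, (fun=> 1), (fun=> u), (fun=> v); rewrite big_ord1 scale1r.
Qed.

End G2Action.

(** * The candidate for the moment map *)

Section MomentMap.

Variables (k : fieldType) (hk2 : (2 \notin [pchar k])%N) (O : octonionAlg k).
Local Notation B := (@octB k O).
Local Notation L := (@oct_lmul k O).
Local Notation R := (@oct_rmul k O).
Local Notation tr := (@lfun_trace _ _).
Local Notation q := (@oct_norm k O).
Local Notation V := (imO O).
Variables (C : algType k) (io : {linear V -> C}).
Hypothesis hC : is_clifford_algebra (fun u : V => - imq u) io.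
Variables (rho : {linear C -> 'End(O)}) (hrho : is_clifford_action io rho).
Local Notation bracket x y := (x * y - y * x).
Local Notation in_g2 := (in_g2 io rho).
Local Notation assoc := (@oct_assoc k O).

Lemma frame_lfunP x y z (xyz : cayley_triple x y z) (f g : 'End(O)) :
  (forall i, (i < 8)%N -> f (nth 0 (frame x y z) i) = g (nth 0 (frame x y z) i)) ->
  f = g.
Proof.
move=> fg; apply/lfunP => w; rewrite (frame_expand hk2 xyz w) !linear_sum.
by apply: eq_bigr => i _; rewrite !linearZ /= fg.
Qed.

(** The element is a combination of the bivectors of the three lines of the Fano
plane through x; both sides are compared on the frame. *)
Lemma lmul_rmul_frame x y z : cayley_triple x y z ->
  exists2 s, in_clifford2 io s & rho s = L x + 2%:R *: R x.
Proof.
move=> xyz; have ei := frame_imag hk2 xyz.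
have im i (hi : (0 < i < 8)%N) := imag_ex hk2 (ei i hi).
have [u2 u2E] := im 2%N isT; have [u3 u3E] := im 3%N isT.
have [u4 u4E] := im 4%N isT; have [u5 u5E] := im 5%N isT.
have [u6 u6E] := im 6%N isT; have [u7 u7E] := im 7%N isT.
exists ((2%:R * q y)^-1 *: bracket (io u2) (io u3) +
  ((2%:R * q z)^-1 *: bracket (io u4) (io u5) +
  (- (2%:R * (q y * q z))^-1 *: bracket (io u6) (io u7) + 0))).
  do 3![apply: clifford2_lincomb; first exact: clifford2_bracket].
  exact: clifford2_0.
have [_ _ [qx qy qz]] := xyz; have two := two_neq0 hk2.
rewrite !(linearP rho) linear0 addr0 !(rho_bracket hrho) u2E u3E u4E u5E u6E u7E.
have mul := frame_mul hk2 xyz.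
apply: (frame_lfunP xyz) => i i8.
rewrite [RHS]add_lfunE [X in _ = _ + X]scale_lfunE rmulE //; last exact: (ei 1%N isT).
rewrite !(add_lfunE, opp_lfunE, scale_lfunE, comp_lfunE, lmulE).
change x with (nth 0 (frame x y z) 1).
do 8?[case: i i8 => [|i] i8] => //; rewrite !mul // !octMZr !mul // /=;
  apply: (octB_nondeg hk2) => w; rewrite !octBlin.
all: by field; rewrite ?qx ?qy ?qz ?two.
Qed.

(** Any anisotropic imaginary element can play the role of the first generator
of a Cayley frame, and such elements span. *)
Lemma lmul_rmul_clifford2 u : imag u ->
  exists2 s, in_clifford2 io s & rho s = L u + 2%:R *: R u.
Proof.
have [x ix qx] := imag_anisotropic hk2 O.
have [y [z xyz]] := cayley_triple_extend hk2 ix qx.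
move=> iu; rewrite (frame_expand_imag hk2 xyz iu).
elim/big_rec: _ => [|i v _ [t ct rt]].
  exists 0; first exact: clifford2_0.
  have L0 : L (0 : O) = 0 by apply/lfunP => v; rewrite lmulE octM0l zero_lfunE.
  by rewrite linear0 /R L0 comp_lfun0l comp_lfun0r oppr0 scaler0 addr0.
have i8 : (0 < i.+1 < 8)%N by rewrite /= ltnS.
have qi : q (nth 0 (frame x y z) i.+1) != 0.
  by rewrite frame_normE // (frame_norm_neq0 xyz).
have [y' [z' xyz']] := cayley_triple_extend hk2 (frame_imag hk2 xyz i8) qi.
have [s cs rs] := lmul_rmul_frame xyz'.
exists (B u (nth 0 (frame x y z) i.+1) / nth 0 (frame_norms (q x) (q y) (q z)) i.+1 *: s + t).
  exact: clifford2_lincomb.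
rewrite linearP /= rs rt lmulD lmulZ rmulP scalerDr addrACA; congr (_ + _).
by rewrite scalerDr !scalerA mulrC.
Qed.

Definition moment_action u v w : O :=
  B u w *: v - B v w *: u - 4%:R^-1 *: assoc u v w.

Lemma imag_moment u v w : imag u -> imag v -> imag w -> imag (moment_action u v w).
Proof.
move=> iu iv iw; have ia := imag_assoc hk2 iu iv iw.
by apply: imagD; [apply: imagD; last apply: imagN|apply: imagN]; apply: imagZ.
Qed.

(** Pair symmetry, as for a curvature tensor: the metric part is visibly
symmetric and the associator part is alternating. *)
Lemma moment_pair u v w z : imag u -> imag v -> imag w -> imag z ->
  B (moment_action u v w) z = B (moment_action w z u) v.
Proof.
move=> iu iv iw iz; rewrite /moment_action.
have : B (assoc u v w) z = B (assoc w z u) v.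
  by rewrite -(assoc_cyc hk2 iw iu iv) assoc_skew34 // assoc23 // octBNl opprK.
move: (assoc u v w) (assoc w z u) => a a' aE; rewrite !octBlin aE.
by rewrite (octBC w u) (octBC z v) (octBC w v) (octBC z u); ring.
Qed.

Lemma imag_nondeg x y : imag x -> imag y ->
  (forall z : V, B x (vsval z) = B y (vsval z)) -> x = y.
Proof.
move=> ix iy xy; apply: (octB_nondeg hk2) => z.
have [u uE] := imag_ex hk2 (imag_proj hk2 z).
have := xy u; rewrite uE !octBlin ix iy => h.
by apply: (eq_lincomb (c := 1) h); ring.
Qed.

(** The element is s = (3/8) [u,v] - (1/8) t, where rho(t) = L_w + 2 R_w and
w = uv - vu.  These coefficients make rho(s) kill the unit, and
[double_commutator] then identifies its action.  Only the first term
contributes to the trace. *)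
Lemma moment_realized (u v : V) : exists s, [/\ in_g2 s,
   forall w : V, rho s (vsval w) = moment_action (vsval u) (vsval v) (vsval w) &
   forall y, in_g2 y -> tr (rho s \o rho y)%VF = - 3%:R * B (rho y (vsval u)) (vsval v)].
Proof.
have four := four_neq0 hk2; have eight := eight_neq0 hk2.
have iV := @imag_val _ hk2 O.
set w0 := vsval u ** vsval v - vsval v ** vsval u.
have iw0 : imag w0 by rewrite /imag octBDl octBNl !octB_mul1 // octBC subrr.
have [t ct rt] := lmul_rmul_clifford2 iw0.
(* The final 0 only shapes the sum for the closure lemma. *)
pose s := (3%:R / 8%:R) *: bracket (io u) (io v) + (- 8%:R^-1 *: t + 0).
have cs : in_clifford2 io s.
  do 2?[apply: clifford2_lincomb => //]; [exact: clifford2_bracket|exact: clifford2_0].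
have rs : rho s = (3%:R / 8%:R) *: ((L (vsval u) \o L (vsval v))%VF
   - (L (vsval v) \o L (vsval u))%VF) - 8%:R^-1 *: (L w0 + 2%:R *: R w0).
  by rewrite /s addr0 linearP linearZ /= rt (rho_bracket hrho) scaleNr.
have rsE y : rho s y = (3%:R / 8%:R) *: (vsval u ** (vsval v ** y)
   - vsval v ** (vsval u ** y)) - 8%:R^-1 *: (w0 ** y + 2%:R *: (y ** w0)).
  rewrite rs add_lfunE scale_lfunE add_lfunE !opp_lfunE scale_lfunE add_lfunE.
  by rewrite scale_lfunE rmulE // !comp_lfunE !lmulE.
exists s; split.
- split=> //; rewrite rsE !octM1 oct1M; apply: (octB_nondeg hk2) => z.
  by rewrite /w0 !octBlin octB0l; field.
- move=> w; rewrite rsE /moment_action; apply: (octB_nondeg hk2) => z.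
  have h1 := congr1 (B^~ z) (double_commutator hk2 (iV u) (iV v) (iV w)).
  have h2 := congr1 (B^~ z) (assoc12 hk2 (vsval w) (iV v) (iV u)).
  rewrite -/w0 in h1; move: h1 h2; rewrite /oct_assoc !octBlin => h1 h2.
  have h3 : w0 ** vsval w = vsval u ** vsval v ** vsval w - vsval v ** vsval u ** vsval w.
    by rewrite /w0 octMDl octMNl.
  have {}h3 := congr1 (B^~ z) h3; rewrite !octBlin in h3.
  apply: (eq_lincomb (c := 4%:R^-1) h1); apply: (eq_lincomb (c := - (3%:R / 8%:R)) h3).
  by apply: (eq_lincomb (c := 3%:R / 8%:R) h2); field; rewrite ?four ?eight.
- move=> y gy; rewrite rs comp_lfunDl comp_lfunNl -!comp_lfunZl (comp_lfunDl (L w0)) -comp_lfunZl.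
  rewrite lfun_traceD lfun_traceN !lfun_traceZ lfun_traceD lfun_traceZ.
  rewrite (trace_bracket hk2 hC hrho) // ![tr (_ \o rho y)%VF]lfun_traceC.
  rewrite (trace_g2_lmul hk2 hrho gy) // (trace_g2_rmul hk2 hC hrho gy) //.
  by field.
Qed.

End MomentMap.

(** * The moment map and its covariants *)

Section Covariants.

Variables (k : fieldType) (hk2 : (2 \notin [pchar k])%N) (hk3 : (3 \notin [pchar k])%N).
Variable O : octonionAlg k.
Local Notation B := (@octB k O).
Local Notation V := (imO O).
Variables (C : algType k) (io : {linear V -> C}).
Hypothesis hC : is_clifford_algebra (fun u : V => - imq u) io.
Variables (rho : {linear C -> 'End(O)}) (hrho : is_clifford_action io rho).
Variables (mu : V -> V -> C) (hmu : is_moment_map io rho mu).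
Local Notation bracket x y := (x * y - y * x).
Local Notation in_g2 := (in_g2 io rho).
Local Notation assoc := (@oct_assoc k O).

Lemma three_neq0 : 3%:R != 0 :> k.
Proof. by move: hk3; rewrite inE. Qed.
Let iV (u : V) : imag (vsval u). Proof. exact: imag_val. Qed.

(** Test the defining equation of the moment map on the element that realises
[moment_action] for a second pair of vectors, and exchange the pairs. *)
Lemma mu_moment u v w :
  vsval (rho_im rho (mu u v) w) = moment_action (vsval u) (vsval v) (vsval w).
Proof.
have gy := moment_in_g2 hmu u v.
have [iy _ _ ->] := g2_vector hk2 hC hrho gy.
apply: (imag_nondeg hk2) => //; first exact: imag_moment.
move=> r; have [s [gs sE str]] := moment_realized hk2 hC hrho w r.
have [_ _ _ simE] := g2_vector hk2 hC hrho gs.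
have := momentE hmu u v gs.
rewrite /g2B (trace_rho_im hk2 hC hrho) // str // /imB simE sE.
rewrite (moment_pair hk2) // => <-; field; exact: three_neq0.
Qed.

Lemma psi_imE v1 v2 v3 : vsval (psi_im rho mu v1 v2 v3) =
  - (3%:R / 4%:R) *: assoc (vsval v1) (vsval v2) (vsval v3).
Proof.
rewrite /psi_im !linearD /= !mu_moment /moment_action.
rewrite (assoc_cyc hk2 (iV v3) (iV v1) (iV v2)).
rewrite -(assoc_cyc hk2 (iV v1) (iV v2) (iV v3)).
apply: (octB_nondeg hk2) => z.
rewrite !octBlin (octBC (vsval v3) (vsval v2)) (octBC (vsval v3) (vsval v1)).
rewrite (octBC (vsval v2) (vsval v1)); field; exact: (four_neq0 hk2).
Qed.

Lemma Q_imE v1 v2 v3 v4 : Q_im rho mu v1 v2 v3 v4 =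
  - 3%:R * B (vsval v1) (assoc (vsval v2) (vsval v3) (vsval v4)).
Proof.
rewrite /Q_im /imB !psi_imE !octBZr.
rewrite ![B (vsval _) (assoc _ _ _)]octBC.
have cyc (a b c d : V) : B (assoc (vsval a) (vsval b) (vsval c)) (vsval d) =
    - B (assoc (vsval b) (vsval c) (vsval d)) (vsval a).
  rewrite (assoc_cyc hk2 (iV a) (iV b) (iV c)).
  exact: (assoc_skew34 hk2 (iV b) (iV c) (iV a) (iV d)).
rewrite (cyc v3 v4 v1 v2) (cyc v4 v1 v2 v3) (cyc v1 v2 v3 v4).
field; exact: (four_neq0 hk2).
Qed.

(** With [clifford2_vector], where delta is now known to be the action of x. *)
Lemma g2_reconstruct x m (e : 'I_m -> V) (n : 'I_m -> k) : in_g2 x ->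
  (forall w, w = \sum_i (imB w (e i) / n i) *: e i) ->
  - 8%:R *: x = \sum_i (n i)^-1 *: bracket (io (rho_im rho x (e i))) (io (e i)).
Proof.
move=> gx he; have [d [dE dskew rec]] := clifford2_vector hk2 hC gx.1.
have [_ _ comm xE] := g2_vector hk2 hC hrho gx.
rewrite -(rec _ e n he); apply: eq_bigr => i _.
suff -> : d (e i) = rho_im rho x (e i) by [].
apply: subvs_inj; rewrite xE; apply/esym.
have := congr1 (fun f : 'End(O) => f '1o) (congr1 rho (dE (e i))).
rewrite linearB !(actionM hrho) !(action_iota hrho) add_lfunE opp_lfunE !comp_lfunE.
by rewrite !lmulE gx.2 octM0r !octM1 subr0 => ->.
Qed.

End Covariants.

(** * Alternating maps and increasing families *)

(** Subsequences of a given size; those of an initial segment of the naturals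
index the basis of an exterior power, in a form that computes. *)
Fixpoint subseqs (T : Type) (n : nat) (s : seq T) : seq (seq T) :=
  match n, s with
  | 0%N, _ => [:: [::]]
  | n'.+1, x :: s' => map (cons x) (subseqs n' s') ++ subseqs n s'
  | _.+1, [::] => [::]
  end.

Lemma mem_subseqs (T : eqType) n (s t : seq T) :
  (t \in subseqs n s) = subseq t s && (size t == n).
Proof.
elim: s n t => [|x s IH] [|n] [|y t] //=; rewrite ?sub0seq ?inE ?andbF //.
- by rewrite mem_cat IH andbF orbF; apply/mapP => -[].
rewrite mem_cat IH /= eqSS; case: (eqVneq y x) => [->|ne].
  rewrite mem_map ?IH; last by move=> a b [].
  case: (boolP (subseq (x :: t) s)) => [st|_]; last by rewrite orbF.
  rewrite (subseq_trans (subseq_cons t x) st) orbb //.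
rewrite (_ : y :: t \in _ = false) //.
by apply/mapP => -[u _ [yx]]; rewrite yx eqxx in ne.
Qed.

Lemma mem_subseqs_iota n m (l : seq nat) :
  (l \in subseqs n (iota 0 m)) = [&& sorted ltn l, all (ltn^~ m) l & size l == n].
Proof.
rewrite mem_subseqs andbA; congr (_ && _); apply/idP/andP => [sl|[sl lm]].
  rewrite (subseq_sorted ltn_trans sl) ?iota_ltn_sorted //; split=> //.
  by apply/allP => i /(mem_subseq sl); rewrite mem_iota.
rewrite (_ : l = [seq i <- iota 0 m | i \in l]) ?filter_subseq //.
apply: (irr_sorted_eq ltn_trans ltnn) => //.
  by rewrite sorted_filter ?iota_ltn_sorted //; apply: ltn_trans.
move=> i; rewrite mem_filter mem_iota /= add0n andbC.
by case: (boolP (i \in l)) => [il|_]; rewrite ?andbF // andbT; apply/esym/(allP lm).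
Qed.

Lemma uniq_subseqs (T : eqType) n (s : seq T) : uniq s -> uniq (subseqs n s).
Proof.
elim: s n => [|x s IH] [|n] //= /andP[xs us].
rewrite cat_uniq map_inj_uniq ?IH // => [|a b [] //]; rewrite andbT.
apply/hasPn => t; rewrite mem_subseqs => /andP[ts _].
by apply/mapP => -[u _ tE]; case/negP: xs; rewrite (mem_subseq ts) // tE mem_head.
Qed.

Section Alternating.

Variables (k : fieldType) (V W : lmodType k) (n : nat) (f : seq V -> W).

(** Multilinear maps are taken here on lists of length n, so that arguments can be
split off, permuted and inserted by list operations.  Vanishing on equal
adjacent arguments is enough for the maps to be alternating. *)
Definition seq_multilinear := forall s1 s2 a x y, (size s1 + size s2).+1 = n ->
  f (s1 ++ (a *: x + y) :: s2) = a *: f (s1 ++ x :: s2) + f (s1 ++ y :: s2).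

Definition seq_alternating := forall s1 s2 x, (size s1 + size s2).+2 = n ->
  f (s1 ++ x :: x :: s2) = 0.

Hypotheses (flin : seq_multilinear) (falt : seq_alternating).

Lemma seq_swap s1 s2 x y : (size s1 + size s2).+2 = n ->
  f (s1 ++ x :: y :: s2) = - f (s1 ++ y :: x :: s2).
Proof.
move=> sz; have lin1 a b c : f (s1 ++ (a + b) :: c :: s2) =
    f (s1 ++ a :: c :: s2) + f (s1 ++ b :: c :: s2).
  by rewrite -[a in LHS]scale1r flin ?scale1r //= addnS.
have lin2 a b c : f (s1 ++ c :: (a + b) :: s2) =
    f (s1 ++ c :: a :: s2) + f (s1 ++ c :: b :: s2).
  by rewrite -[a in LHS]scale1r -!(cat_rcons c) flin ?scale1r //= size_rcons addSn.
have := falt (x + y) sz; rewrite lin1 !lin2 !falt // add0r addr0 => /eqP.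
by rewrite addr_eq0 => /eqP.
Qed.

Variable e : nat -> V.

(** One step of insertion sort.  The prefix s is arbitrary, which lets the next
lemma sort the tail of a list first. *)
Lemma insert_basis x l : sorted leq l -> exists l',
  [/\ sorted leq l', perm_eq l' (x :: l) & forall s, (size s + size l')%N = n ->
   f (s ++ map e l') = 0 -> f (s ++ map e (x :: l)) = 0].
Proof.
elim: l => [|y l IH] sl; first by exists [:: x].
case: (leqP x y) => [xy|/ltnW yx]; first by exists [:: x, y & l] => /=; rewrite xy.
have [l' [sl' pl' fl']] := IH (path_sorted sl).
exists (y :: l'); split.
- rewrite /= path_min_sorted // (perm_all _ pl') /= yx.
  exact: order_path_min leq_trans sl.
- apply: (@perm_trans _ (y :: x :: l)); first by rewrite perm_cons.
  by rewrite (perm_catCA [:: y] [:: x] l) /=.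
have szl : size l' = (size l).+1 by rewrite (perm_size pl').
move=> s sz /=; rewrite -cat_rcons => f0.
rewrite seq_swap ?size_map; last by rewrite -sz /= szl !addnS.
by rewrite -cat_rcons (fl' (rcons s (e y))) ?oppr0 // size_rcons -sz addSnnS.
Qed.

Lemma sort_basis l : exists l',
  [/\ sorted leq l', perm_eq l' l & forall s, (size s + size l')%N = n ->
   f (s ++ map e l') = 0 -> f (s ++ map e l) = 0].
Proof.
elim: l => [|x l [l1 [s1 p1 f1]]]; first by exists [::].
have [l2 [s2 p2 f2]] := insert_basis x s1.
have sz1 := perm_size p1; have sz2 := perm_size p2.
exists l2; split=> // [|s sz f0].
  by rewrite (perm_trans p2) // perm_cons.
have sz' : (size s + size l1).+1 = n by rewrite -sz sz2 addnS.
rewrite /= -cat_rcons f1 ?size_rcons ?addSn // cat_rcons.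
by apply: f2; rewrite // sz2 addnS /=.
Qed.

Lemma alternating_basis_eq0 m :
  (forall l, l \in subseqs n (iota 0 m) -> f (map e l) = 0) ->
  forall l, all (ltn^~ m) l -> size l = n -> f (map e l) = 0.
Proof.
move=> f0 l lm sz; have [l' [sl pl fl]] := sort_basis l.
have sz' := perm_size pl; apply: (fl [::]); rewrite ?sz' //=.
have [sl'|nsl] := boolP (sorted ltn l').
  by apply: f0; rewrite mem_subseqs_iota sl' (perm_all _ pl) lm sz' sz eqxx.
have [a [b [x l'E]]] : exists a b x, l' = a ++ x :: x :: b.
  elim: (l') sl nsl => [|x [|y t] IH] //= /andP[xy st].
  rewrite negb_and -leqNgt => /orP[yx|nst].
    by exists [::], t, x; congr [:: _, _ & _]; apply/eqP; rewrite eqn_leq xy yx.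
  by have [a [b [z ->]]] := IH st nst; exists (x :: a), b, z.
rewrite l'E map_cat /= falt // !size_map -sz -sz' l'E size_cat /= !addnS //.
Qed.

(** Arguments are expanded on the spanning family from the last to the first;
once all of them are basis vectors, sorting makes the family increasing up to
sign or exhibits two equal adjacent vectors. *)
Lemma alternating_eq0 m :
  (forall x, exists c : 'I_m -> k, x = \sum_i c i *: e i) ->
  (forall l, l \in subseqs n (iota 0 m) -> f (map e l) = 0) ->
  forall s, size s = n -> f s = 0.
Proof.
move=> span f0.
have f_mixed s l : all (ltn^~ m) l -> (size s + size l)%N = n -> f (s ++ map e l) = 0.
  elim/last_ind: s l => [|s x IH] l lm; first exact: (alternating_basis_eq0 f0).
  rewrite size_rcons addSn => sz.
  have [c ->] := span x; rewrite cat_rcons.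
  have fE y i : f (s ++ (c i *: e i + y) :: map e l) = f (s ++ y :: map e l).
    rewrite flin ?size_map // -[e i :: _]/(map e (val i :: l)) IH /= ?ltn_ord //.
      by rewrite scaler0 add0r.
    by rewrite addnS.
  elim/big_rec: _ => [|i y _ fy]; last by rewrite fE.
  have := flin (s1 := s) (s2 := map e l) (-1) 0 0.
  by rewrite size_map scaler0 addr0 scaleN1r addNr => /(_ sz).
by move=> s sz; have := f_mixed s [::] isT; rewrite cats0; apply; rewrite addn0.
Qed.

End Alternating.

(** * Inverse of the Gram pairing on exterior powers *)

Section TupleForms.

Variables (k : fieldType) (V W : lmodType k) (n : nat) (f : n.-tuple V -> W).

Definition tuple_of_seq (s : seq V) : n.-tuple V := [tuple s`_i | i < n].

Lemma tuple_of_seq_tuple (v : n.-tuple V) : tuple_of_seq v = v.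
Proof. by apply: eq_from_tnth => i; rewrite tnth_mktuple (tnth_nth 0). Qed.

Lemma multilinear_seq : multilinear f -> seq_multilinear n (f \o tuple_of_seq).
Proof.
move=> mf s1 s2 a x y sz.
have i_lt : (size s1 < n)%N by rewrite -sz ltnS leq_addr.
have set_at z : tuple_of_seq (s1 ++ z :: s2) =
    tuple_set (tuple_of_seq (s1 ++ 0 :: s2)) (Ordinal i_lt) z.
  apply: eq_from_tnth => j; rewrite !tnth_mktuple -val_eqE /=.
  rewrite !nth_cat; case: (ltngtP j (size s1)) => [//|j_gt|->]; last by rewrite subnn.
  by move: j_gt; rewrite -subn_gt0; case: (j - size s1)%N.
by rewrite /= (set_at (a *: x + y)) (set_at x) (set_at y) mf.
Qed.

Lemma alternating_seq : alternating f -> seq_alternating n (f \o tuple_of_seq).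
Proof.
move=> af s1 s2 x sz.
have i_lt : (size s1 < n)%N by rewrite -sz ltnS -addnS leq_addr.
have j_lt : ((size s1).+1 < n)%N by rewrite -sz !ltnS leq_addr.
apply: (af _ (Ordinal i_lt) (Ordinal j_lt)).
  by rewrite -val_eqE /= neq_ltn leqnn.
by rewrite !tnth_mktuple /= !nth_cat ltnn subnn ltnNge leqnSn /= subSn // subnn.
Qed.

End TupleForms.

Section ExteriorPower.

Variables (k : fieldType) (O : octonionAlg k) (n m : nat).
Local Notation V := (imO O).
Variables (L : vectType k) (wedge : n.-tuple V -> L) (hL : is_exterior_power wedge).
Variables (eta : 'Hom(L, 'Hom(L, k^o))) (heta : is_eta wedge eta).
Variables (e : nat -> V).
Hypothesis e_span : forall x, exists c : 'I_m -> k, x = \sum_i c i *: e i.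
Hypothesis e_orth : forall i j, (i < m)%N -> (j < m)%N -> i != j -> imB (e i) (e j) = 0.
Hypothesis e_anis : forall i, (i < m)%N -> imB (e i) (e i) != 0.

Local Notation w l := (wedge (tuple_of_seq n (map e l))).
Local Notation index_set := (subseqs n (iota 0 m)).
Definition gram_norm (l : seq nat) : k := \prod_(i < n) imB (e (nth 0%N l i)) (e (nth 0%N l i)).

Lemma index_setP l : l \in index_set ->
  [/\ sorted ltn l, size l = n & forall i, (i < n)%N -> (nth 0%N l i < m)%N].
Proof.
rewrite mem_subseqs_iota => /and3P[sl /allP lm /eqP sz]; split=> // i ni.
by apply: lm; rewrite mem_nth ?sz.
Qed.

(** An increasing family other than l' of the same size has a member outside l',
which gives a zero row in the Gram matrix. *)
Lemma eta_basis l l' : l \in index_set -> l' \in index_set ->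
  eta (w l) (w l') = if l == l' then gram_norm l else 0.
Proof.
move=> hl hl'; have [sl szl lm] := index_setP hl; have [sl' szl' lm'] := index_setP hl'.
rewrite heta; set A := \matrix_(a, b) _.
have AE a b : A a b = imB (e (nth 0%N l a)) (e (nth 0%N l' b)).
  by rewrite mxE !tnth_mktuple !(nth_map 0%N) ?szl ?szl'.
case: eqVneq => [ll'|nll'].
  have -> : A = diag_mx (\row_(i < n) imB (e (nth 0%N l i)) (e (nth 0%N l i))).
    apply/matrixP => a b; rewrite AE !mxE -ll'; case: (eqVneq a b) => [->|ab] //.
    rewrite mulr0n e_orth ?lm // nth_uniq ?szl //.
    exact: (sorted_uniq ltn_trans ltnn).
  by rewrite det_diag; apply: eq_bigr => i _; rewrite mxE.
have [a la] : exists a : 'I_n, nth 0%N l a \notin l'.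
  apply/existsP; rewrite -negb_forall; apply: contra nll' => /forallP sub.
  have ul := sorted_uniq ltn_trans ltnn sl.
  have sub' : {subset l <= l'}.
    by move=> i /(nthP 0%N)[a]; rewrite szl => an <-; exact: (sub (Ordinal an)).
  have [_ ll'] := uniq_min_size ul sub' (eq_leq (etrans szl' (esym szl))).
  exact/eqP/(irr_sorted_eq ltn_trans ltnn sl sl').
rewrite (expand_det_row _ a) big1 // => b _.
rewrite AE e_orth ?mul0r ?lm ?lm' //; apply: contra la => /eqP ->.
by rewrite mem_nth // szl'.
Qed.

Lemma gram_norm_neq0 l : l \in index_set -> gram_norm l != 0.
Proof.
case/index_setP => _ _ lm; rewrite prodf_seq_neq0; apply/allP => i _ /=.
by rewrite e_anis ?lm.
Qed.

Lemma uniq_index : uniq index_set.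
Proof. exact/uniq_subseqs/iota_uniq. Qed.

(** The right-hand side is linear in x.  By uniqueness in the universal property
it is enough to compare both sides on decomposable elements, where they are
alternating multilinear, hence on increasing families. *)
Lemma wedge_expand x : x = \sum_(l <- index_set) (eta x (w l) / gram_norm l) *: w l.
Proof.
pose h x := \sum_(l <- index_set) (eta x (w l) / gram_norm l) *: w l.
have hlin : linear h.
  move=> a u v; rewrite /h scaler_sumr -big_split /=; apply: eq_bigr => l _.
  rewrite linearP /= add_lfunE scale_lfunE scalerA -scalerDl; congr (_ *: _).
  by rewrite mulrDl mulrA.
pose H : {linear L -> L} := HB.pack h (GRing.isSemilinear.Build k L L _ h
  (GRing.semilinear_linear hlin)).
suff E v : wedge v = h (wedge v).
  exact: (wedge_lift_unique hL (g := idfun : {linear L -> L}) (h := H) E x).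
pose g v := wedge v - h (wedge v).
have gmul : multilinear g.
  move=> t i a u z; rewrite /g (wedge_multilinear hL t i) hlin scalerBr.
  by rewrite opprD addrACA.
have galt : alternating g.
  move=> t i j ij tij; rewrite /g (wedge_alternating hL ij tij).
  by have -> : h 0 = 0 := linear0 H; rewrite subr0.
apply/eqP; rewrite -subr_eq0 -/(g v) -[v]tuple_of_seq_tuple; apply/eqP.
apply: (alternating_eq0 (multilinear_seq gmul) (alternating_seq galt) e_span);
  last exact: size_tuple.
move=> l hl; rewrite /= /g /h (bigD1_seq l) ?uniq_index //= eta_basis // eqxx.
rewrite divff ?gram_norm_neq0 // scale1r opprD addrA subrr sub0r big_seq_cond.
rewrite big1 ?oppr0 // => l' /andP[hl' nll'].
by rewrite eta_basis // eq_sym (negbTE nll') mul0r scale0r.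
Qed.

Lemma eta_inj : lker eta == 0%VS.
Proof.
apply/lker0P => x y exy; rewrite [x]wedge_expand [y]wedge_expand.
by apply: eq_bigr => l _; rewrite exy.
Qed.

Lemma eta_inv (Q : 'Hom(L, k^o)) :
  (eta^-1)%VF Q = \sum_(l <- index_set) (Q (w l) / gram_norm l) *: w l.
Proof.
have inj := lker0_lfunK eta_inj; set x := RHS.
suff <- : eta x = Q by rewrite inj.
apply/lfunP => y; rewrite [y]wedge_expand !linear_sum big_seq [RHS]big_seq.
apply: eq_bigr => l hl; rewrite !linearZ /=; congr (_ * _).
rewrite sum_lfunE (bigD1_seq l) ?uniq_index //= linearZ scale_lfunE eta_basis //.
rewrite eqxx big_seq_cond big1 => [|l' /andP[hl' nll']].
  by rewrite addr0 -[LHS]/(_ * _) divfK // gram_norm_neq0.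
by rewrite linearZ /= scale_lfunE eta_basis // (negbTE nll') scaler0.
Qed.

End ExteriorPower.

(** * The multivector of the alternating 4-form *)

Section ImagFrame.

Variables (k : fieldType) (hk2 : (2 \notin [pchar k])%N) (O : octonionAlg k).
Local Notation B := (@octB k O).
Local Notation q := (@oct_norm k O).
Local Notation V := (imO O).
Local Notation assoc := (@oct_assoc k O).
Variables (x y z : O) (xyz : cayley_triple x y z).
Local Notation e := (nth 0 (frame x y z)).
Local Notation n := (nth 0 (frame_norms (q x) (q y) (q z))).
Local Notation c := (fun i j => nth 0 (nth [::] (frame_coefs (q x) (q y) (q z)) i) j).
Local Notation m i j := (nth 0%N (nth [::] frame_index i) j).

Lemma frame_index_lt i j : (i < 8)%N -> (j < 8)%N -> (m i j < 8)%N.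
Proof.
have : all (fun i => all (fun j => (m i j < 8)%N) (iota 0 8)) (iota 0 8) by [].
by move=> /allP h i8 j8; apply: (allP (h i _)); rewrite mem_iota.
Qed.

Lemma frame_indexA i j l : (i < 8)%N -> (j < 8)%N -> (l < 8)%N ->
  m i (m j l) = m (m i j) l.
Proof.
have : all (fun i => all (fun j => all (fun l => m i (m j l) == m (m i j) l)
  (iota 0 8)) (iota 0 8)) (iota 0 8) by vm_compute.
move=> /allP h i8 j8 l8; apply/eqP.
by apply: (allP (allP (h i _) j _)); rewrite mem_iota.
Qed.

Lemma frame_assoc i j l : (i < 8)%N -> (j < 8)%N -> (l < 8)%N ->
  assoc (e i) (e j) (e l) =
  (c i j * c (m i j) l - c j l * c i (m j l)) *: e (m (m i j) l).
Proof.
move=> i8 j8 l8; rewrite /oct_assoc !(frame_mul hk2 xyz) // octMZl octMZr.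
rewrite !(frame_mul hk2 xyz) ?frame_index_lt // !scalerA frame_indexA //.
by rewrite -scalerBl.
Qed.

Lemma frame_B i j : (i < 8)%N -> (j < 8)%N -> B (e i) (e j) = if i == j then n i else 0.
Proof.
move=> i8 j8; case: eqVneq => [->|ij]; last exact: frame_orth.
by rewrite octBE // frame_normE.
Qed.

Definition imframe i : V := vsproj (im_space O) (e i.+1).
Local Notation f := imframe.

Lemma imframeE i : (i < 7)%N -> vsval (f i) = e i.+1.
Proof. by move=> i7; rewrite vsprojK //; apply/imag_spaceP => //; apply: frame_imag. Qed.

Lemma imframe_expand w : w = \sum_(i < 7) (imB w (f i) / n i.+1) *: f i.
Proof.
apply: subvs_inj; rewrite linear_sum [LHS](frame_expand_imag hk2 xyz (imag_val hk2 w)).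
by apply: eq_bigr => i _; rewrite linearZ /= /imB imframeE.
Qed.

Lemma imframe_orth i j : (i < 7)%N -> (j < 7)%N -> i != j -> imB (f i) (f j) = 0.
Proof. by move=> i7 j7 ij; rewrite /imB !imframeE // frame_B // eqSS (negbTE ij). Qed.

Lemma imframe_norm i : (i < 7)%N -> imB (f i) (f i) = n i.+1.
Proof. by move=> i7; rewrite /imB imframeE // frame_B // eqxx. Qed.

End ImagFrame.

Section CoassociativeMultivector.
Variables (k : fieldType) (hk2 : (2 \notin [pchar k])%N) (O : octonionAlg k).
Local Notation V := (imO O).
Local Notation B := (@octB k O).
Local Notation assoc := (@oct_assoc k O).

(** A Cayley basis e1, ..., e7 is the imaginary part of the frame of e1, e2, e4. *)
Lemma cayley_basis_triple (e1 e2 e3 e4 e5 e6 e7 : V) :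
  is_cayley_basis e1 e2 e3 e4 e5 e6 e7 ->
  cayley_triple (vsval e1) (vsval e2) (vsval e4) /\
  forall i, (i < 7)%N -> imframe (vsval e1) (vsval e2) (vsval e4) i =
    nth 0 [:: e1; e2; e3; e4; e5; e6; e7] i.
Proof.
case=> h3 h5 h6 h7 _ o a.
have xyz : cayley_triple (vsval e1) (vsval e2) (vsval e4).
  move: o a => /= /andP[/and5P[/eqP o12 _ /eqP o14 _ _]].
  move=> /andP[/and4P[_ /eqP o24 _ _]] /andP[/andP[/eqP o34 _] _].
  move=> /and5P[a1 a2 _ a4 _].
  by split; split=> //; first [exact: imag_val | rewrite -h3].
split=> // i i7; apply: subvs_inj; rewrite imframeE //.
by do 7?[case: i i7 => [|i] i7] => //=; rewrite ?h3 ?h5 ?h6 ?h7.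
Qed.

Lemma tuple_of_seq4 (a b c d : V) : tuple_of_seq 4 [:: a; b; c; d] = [tuple a; b; c; d].
Proof. by rewrite -[RHS]tuple_of_seq_tuple. Qed.

Lemma eta_inv_form (L : vectType k) (wedge : 4.-tuple V -> L)
  (hL : is_exterior_power wedge)
  (eta : 'Hom(L, 'Hom(L, k^o))) (heta : is_eta wedge eta)
  (Q : 'Hom(L, k^o))
  (hQ : forall v1 v2 v3 v4 : V, Q (wedge [tuple v1; v2; v3; v4]) =
     - 3%:R * B (vsval v1) (assoc (vsval v2) (vsval v3) (vsval v4)))
             (e1 e2 e3 e4 e5 e6 e7 : imO O)
             (he : is_cayley_basis e1 e2 e3 e4 e5 e6 e7) :
        (eta^-1)%VF Q
        = (6%:R / (imq e1 * imq e2 * imq e4)) *: wedge [tuple e1; e2; e4; e7]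
        - (6%:R / (imq e1 * imq e2 * imq e4)) *: wedge [tuple e1; e2; e5; e6]
        - (6%:R / (imq e1 * imq e2 * imq e4)) *: wedge [tuple e1; e3; e4; e6]
        - (6%:R / (imq e1 ^+ 2 * imq e2 * imq e4)) *: wedge [tuple e1; e3; e5; e7]
        + (6%:R / (imq e1 * imq e2 * imq e4)) *: wedge [tuple e2; e3; e4; e5]
        - (6%:R / (imq e1 * imq e2 ^+ 2 * imq e4)) *: wedge [tuple e2; e3; e6; e7]
        - (6%:R / (imq e1 * imq e2 * imq e4 ^+ 2)) *: wedge [tuple e4; e5; e6; e7].
Proof.
have [xyz eE] := cayley_basis_triple he.
set x := vsval e1 in xyz eE; set y := vsval e2 in xyz eE; set z := vsval e4 in xyz eE.
pose a := oct_norm x; pose b := oct_norm y; pose c := oct_norm z.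
pose n := nth 0 (frame_norms a b c).
pose cf i j := nth 0 (nth [::] (frame_coefs a b c) i) j.
pose m i j := nth 0%N (nth [::] frame_index i) j.
(* The four indices are positions in the frame, shifted by one with respect to
   the imaginary basis; the test says that the first vector is proportional to
   the associator of the other three. *)
pose F i j l r := - 3%:R * ((cf j l * cf (m j l) r - cf l r * cf j (m l r)) *
  if i == m (m j l) r then n i else 0) / (n i * n j * n l * n r).
have span w : exists c : 'I_7 -> k, w = \sum_i c i *: imframe x y z i.
  by eexists; apply: (imframe_expand hk2 xyz w).
rewrite (eta_inv hL heta span (imframe_orth hk2 xyz)); last first.
  by move=> i i7; rewrite (imframe_norm hk2 xyz) // frame_norm_neq0.
have step l : l \in subseqs 4 (iota 0 7) ->
  (Q (wedge (tuple_of_seq 4 (map (imframe x y z) l))) / gram_norm 4 (imframe x y z) l)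
     *: wedge (tuple_of_seq 4 (map (imframe x y z) l)) =
  let s := nth 0%N l in
  F (s 0).+1 (s 1).+1 (s 2).+1 (s 3).+1 *: 
    wedge (tuple_of_seq 4 (map (nth 0 [:: e1; e2; e3; e4; e5; e6; e7]) l)).
  move=> /index_setP[_ + lt7]; case: l lt7 => [|i [|j [|r [|s []]]]] // lt7 _.
  have [i7 j7 r7 s7] := And4 (lt7 0 isT) (lt7 1 isT) (lt7 2 isT) (lt7 3 isT).
  rewrite /= in i7 j7 r7 s7 *; rewrite -!eE // !tuple_of_seq4; congr (_ *: _).
  rewrite hQ !imframeE // (frame_assoc hk2 xyz) // octBZr (frame_B hk2 xyz) ?frame_index_lt //.
  rewrite /F /gram_norm !big_ord_recl big_ord0 /= !(imframe_norm hk2 xyz) //.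
  by rewrite mulr1 !mulrA.
rewrite (eq_big_seq _ step) /=.
rewrite !big_cons big_nil /F /= !tuple_of_seq4 !(mulr0, mul0r, scale0r, add0r, addr0).
have [_ _ [a0 b0 c0]] := xyz.
rewrite -!scaleNr -!addrA.
by congr (_ *: _ + (_ *: _ + (_ *: _ + (_ *: _ + (_ *: _ + (_ *: _ + _ *: _))))));
  rewrite /imq -/x -/y -/z -/a -/b -/c /cf /m /n /=; field; rewrite ?a0 ?b0 ?c0.
Qed.
End CoassociativeMultivector.

(** * Sums over shuffles *)

Section OneLine.

(** Permutations do not reduce by computation, but their one-line notations do. *)
Definition one_line n (s : 'S_n) : seq nat := [seq val (s i) | i <- enum 'I_n].

(** One-line notations with parities: a permutation of n + 1 elements is given by
the image j of 0 and a permutation of the others, and [bump] skips j. *)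
Fixpoint signed_perms n : seq (bool * seq nat) :=
  if n is n'.+1 then
    [seq (odd j (+) p.1, j :: map (bump j) p.2) | j <- iota 0 n, p <- signed_perms n']
  else [:: (false, [::])].

Lemma lift_perm0_bij n :
  bijective (fun p : 'I_n.+1 * 'S_n => lift_perm ord0 p.1 p.2).
Proof.
apply: inj_card_bij => [[i s] [j t] /= /permP eq_st|].
  have ij : i = j by have := eq_st ord0; rewrite !lift_perm_id.
  congr (_, _) => //; apply/permP => x; have := eq_st (lift ord0 x).
  by rewrite !lift_perm_lift ij => /lift_inj.
by rewrite card_prod card_ord !card_Sn factS.
Qed.

Lemma size_one_line n (s : 'S_n) : size (one_line s) = n.
Proof. by rewrite size_map size_enum_ord. Qed.

Lemma nth_one_line n (s : 'S_n) (i : 'I_n) : nth 0%N (one_line s) i = s i.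
Proof. by rewrite (nth_map i) ?size_enum_ord // nth_ord_enum. Qed.

Lemma one_line_lift n (j : 'I_n.+1) (s : 'S_n) :
  one_line (lift_perm ord0 j s) = val j :: map (bump j) (one_line s).
Proof.
rewrite /one_line enum_ordSl /= lift_perm_id -!map_comp; congr (_ :: _).
by apply: eq_map => i /=; rewrite lift_perm_lift.
Qed.

Lemma sum_signed_perms (V : nmodType) n (G : bool -> seq nat -> V) :
  \sum_(s : 'S_n) G (odd_perm s) (one_line s) = \sum_(p <- signed_perms n) G p.1 p.2.
Proof.
elim: n G => [|n IH] G.
  rewrite (big_pred1 1%g) => [|s]; last by apply/esym/eqP/permP => -[].
  by rewrite odd_perm1 /one_line (size0nil (size_enum_ord 0)) /= big_seq1.
have [h hK Kh] := lift_perm0_bij n.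
rewrite (reindex (fun p : 'I_n.+1 * 'S_n => lift_perm ord0 p.1 p.2)); last first.
  by exists h => p _; [apply: hK|apply: Kh].
rewrite -(pair_bigA _ (fun j s => G (lift_perm ord0 j s) (one_line (lift_perm ord0 j s)))) /=.
rewrite -[RHS]/(\sum_(p <- [seq (odd j (+) p.1, j :: map (bump j) p.2) |
   j <- iota 0 n.+1, p <- signed_perms n]) G p.1 p.2).
rewrite big_allpairs_dep -val_enum_ord big_map big_enum /=; apply: eq_bigr => j _.
rewrite -(IH (fun b l => G (odd j (+) b) (val j :: map (bump j) l))).
by apply: eq_bigr => s _; rewrite odd_lift_perm one_line_lift.
Qed.

Definition shuffle_line p (l : seq nat) : bool :=
  let n := size l in
  all (fun i => all (fun j =>
    (i < j)%N && ((j < p)%N || (p <= i)%N) ==> (nth 0%N l i < nth 0%N l j)%N)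
      (iota 0 n)) (iota 0 n).

Lemma is_shuffleE p n (s : 'S_n) : is_shuffle p s = shuffle_line p (one_line s).
Proof.
rewrite /shuffle_line size_one_line; apply/'forall_forallP/allP => [h i|h i j].
  rewrite mem_iota => i_lt; apply/allP => j; rewrite mem_iota => j_lt.
  by have := h (Ordinal i_lt) (Ordinal j_lt); rewrite -!nth_one_line.
have iota_ord (a : 'I_n) : val a \in iota 0 n by rewrite mem_iota ltn_ord.
by have /allP/(_ _ (iota_ord j)) := h _ (iota_ord i); rewrite !nth_one_line.
Qed.

Definition shuffles p n := [seq r <- signed_perms n | shuffle_line p r.2].

Lemma sum_shuffles (V : nmodType) p n (G : bool -> seq nat -> V) :
  \sum_(s : 'S_n | is_shuffle p s) G (odd_perm s) (one_line s) =
  \sum_(r <- shuffles p n) G r.1 r.2.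
Proof.
rewrite big_mkcond big_filter [RHS]big_mkcond.
rewrite -(@sum_signed_perms V n (fun b l => if shuffle_line p l then G b l else 0)).
by apply: eq_bigr => s _; rewrite is_shuffleE.
Qed.

End OneLine.

Section ShuffleSum.

Variables (k : fieldType) (V : lmodType k).

(** Each variable occurs exactly once in the permuted list of arguments. *)
Lemma seq_multilinear_perm (F : seq V -> k^o) n l : perm_eq l (iota 0 n) ->
  seq_multilinear n F -> seq_multilinear n (fun s => F (map (nth 0 s) l)).
Proof.
move=> pl mF s1 s2 a x y sz; have sl := perm_size pl; rewrite size_iota in sl.
have ul : uniq l by rewrite (perm_uniq pl) iota_uniq.
have il : size s1 \in l by rewrite (perm_mem pl) mem_iota -sz ltnS leq_addr.
case/splitPr: il sl ul => l1 l2 sl ul.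
move: ul; rewrite cat_uniq /= negb_or => /and3P[_ /andP[nl1 _] /andP[nl2 _]].
have off (t : seq nat) z : size s1 \notin t ->
    map (nth 0 (s1 ++ z :: s2)) t = map (nth 0 (s1 ++ 0 :: s2)) t.
  move=> nt; apply/eq_in_map => j jt; rewrite !nth_cat.
  case: (ltngtP j (size s1)) => [//|j_gt|je]; last by rewrite -je jt in nt.
  by move: j_gt; rewrite -subn_gt0; case: (j - size s1)%N.
have at_ z : map (nth 0 (s1 ++ z :: s2)) (l1 ++ size s1 :: l2) =
    map (nth 0 (s1 ++ 0 :: s2)) l1 ++ z :: map (nth 0 (s1 ++ 0 :: s2)) l2.
  by rewrite map_cat /= nth_cat ltnn subnn /= !off.
rewrite (at_ (a *: x + y)) (at_ x) (at_ y) mF //.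
by rewrite !size_map -sl size_cat /= addnS.
Qed.

Definition shuffle_sum p n (F : seq V -> k) (s : seq V) : k :=
  \sum_(r <- shuffles p n) (-1) ^+ r.1 * F (map (nth 0 s) r.2).

Lemma shuffle_sum_multilinear p n F : 
  all (fun r => perm_eq r.2 (iota 0 n)) (shuffles p n) ->
  seq_multilinear n (F : seq V -> k^o) ->
  seq_multilinear n (shuffle_sum p n F : seq V -> k^o).
Proof.
move=> /allP pl mF s1 s2 a x y sz; rewrite /shuffle_sum scaler_sumr -big_split /=.
rewrite big_seq [RHS]big_seq; apply: eq_bigr => r /pl pr.
by rewrite (seq_multilinear_perm pr mF) // mulrDr; congr (_ + _); exact: mulrCA.
Qed.

(** The excluded pair of adjacent positions is the one that straddles the
boundary between the first p arguments and the others. *)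
Definition block_alternating p n (F : seq V -> k) := forall s1 s2 x,
  (size s1 + size s2).+2 = n -> (size s1).+1 != p -> F (s1 ++ x :: x :: s2) = 0.

(** If two adjacent arguments are equal, each shuffle either puts them in the same
block, next to each other, or is paired with the shuffle that exchanges them,
which has the opposite sign and the same value. *)
Lemma shuffle_sum_alternating p (F : seq V -> k) : p \in [:: 3; 4] ->
  block_alternating p 6 F -> seq_alternating 6 (shuffle_sum p 6 F : seq V -> k^o).
Proof.
move=> p34 bF s1 s2 x [] sz.
have h01 a b c d y : F [:: y; y; a; b; c; d] = 0.
  by apply: (bF [::]) => //=; apply: contraTneq p34 => <-.
have h12 a b c d y : F [:: a; y; y; b; c; d] = 0.
  by apply: (bF [:: a]) => //=; apply: contraTneq p34 => <-.
have h23 a b c d y : 3 != p -> F [:: a; b; y; y; c; d] = 0 by exact: (bF [:: a; b]).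
have h34 a b c d y : 4 != p -> F [:: a; b; c; y; y; d] = 0 by exact: (bF [:: a; b; c]).
have h45 a b c d y : F [:: a; b; c; d; y; y] = 0.
  by apply: (bF [:: a; b; c; d]) => //=; apply: contraTneq p34 => <-.
rewrite /shuffle_sum; set t := shuffles p 6; move: p34 @t h23 h34 {bF}; rewrite !inE.
case/orP=> /eqP -> t h23 h34; vm_compute in t; rewrite {}/t;
  [have hmid := fun a b c d y => h34 a b c d y isT
  |have hmid := fun a b c d y => h23 a b c d y isT];
  case: s1 s2 sz => [|a [|b [|c [|d [|? ?]]]]] [|a' [|b' [|c' [|d' [|? ?]]]]] //= _;
  rewrite !big_cons big_nil /=;
  by rewrite ?h01 ?h12 ?hmid ?h45; ring.
Qed.

End ShuffleSum.

(** * Vanishing in degree six *)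

Section DegreeSix.

Variables (k : fieldType) (hk2 : (2 \notin [pchar k])%N) (hk3 : (3 \notin [pchar k])%N).
Variable O : octonionAlg k.
Local Notation B := (@octB k O).
Local Notation q := (@oct_norm k O).
Local Notation V := (imO O).
Variables (C : algType k) (io : {linear V -> C}).
Hypothesis hC : is_clifford_algebra (fun u : V => - imq u) io.
Variables (rho : {linear C -> 'End(O)}) (hrho : is_clifford_action io rho).
Variables (mu : V -> V -> C) (hmu : is_moment_map io rho mu).
Local Notation bracket x y := (x * y - y * x).
Local Notation in_g2 := (in_g2 io rho).
Local Notation assoc := (@oct_assoc k O).

Let iV (u : V) : imag (vsval u). Proof. exact: imag_val. Qed.

(** Against the elements of g that realise [moment_action], the hypothesis says
that the combination acts by zero on vectors; it is then zero in the Clifford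
algebra by [g2_reconstruct]. *)
Lemma mu_sum_eq0 I (r : seq I) (c : I -> k) (a b : I -> V) :
  (forall s, in_g2 s -> \sum_(i <- r) c i * B (rho s (vsval (a i))) (vsval (b i)) = 0) ->
  \sum_(i <- r) c i *: mu (a i) (b i) = 0.
Proof.
move=> h; have [x ix qx] := imag_anisotropic hk2 O.
have [y [z xyz]] := cayley_triple_extend hk2 ix qx.
have act0 w : \sum_(i <- r) c i *: rho_im rho (mu (a i) (b i)) w = 0.
  apply: subvs_inj; apply: (imag_nondeg hk2) => // t.
  have [s [gs sE _]] := moment_realized hk2 hC hrho w t.
  rewrite linear0 octB0l linear_sum linear_sumlz -[RHS](h s gs).
  apply: eq_bigr => i _; rewrite linearZ /= octBZl (mu_moment hk2 hk3 hC hrho hmu).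
  by rewrite moment_pair // -sE.
have eight : - 8%:R != 0 :> k by rewrite oppr_eq0 eight_neq0.
apply: (scalerI eight); rewrite scaler0 scaler_sumr.
under eq_bigr do rewrite scalerA mulrC -scalerA
  (g2_reconstruct hk2 hC hrho (moment_in_g2 hmu _ _) (imframe_expand hk2 xyz)) scaler_sumr.
rewrite exchange_big /= big1 // => j _.
transitivity ((nth 0 (frame_norms (q x) (q y) (q z)) j.+1)^-1 *:
  bracket (io (\sum_(i <- r) c i *: rho_im rho (mu (a i) (b i)) (imframe x y z j))) (io (imframe x y z j))).
  rewrite linear_sum mulr_suml mulr_sumr -sumrB scaler_sumr; apply: eq_bigr => i _.
  have -> t : io (c i *: t) = c i *: io t by rewrite linearZ.
  by rewrite -scalerAl -scalerAr -scalerBr !scalerA mulrC.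
by rewrite act0 linear0 mul0r mulr0 subrr scaler0.
Qed.

Section Derivation.
Variables (s : C) (gs : in_g2 s).
Local Notation om u v := (B (rho s u) v).

Lemma g2form_skew u v : imag u -> imag v -> om u v = - om v u.
Proof.
move=> iu iv; have [_ sk _ _] := g2_vector hk2 hC hrho gs.
have [u' <-] := imag_ex hk2 iu; have [v' <-] := imag_ex hk2 iv.
by rewrite sk octBC.
Qed.

Lemma g2form_1l u : om '1o u = 0.
Proof. by rewrite gs.2 octB0l. Qed.

Lemma g2form_1r u : om u '1o = 0.
Proof. exact: (g2_imag hk2 hC hrho). Qed.

Lemma g2form_xx u : imag u -> om u u = 0.
Proof. by move=> iu; apply/(opp_self_eq0 hk2)/g2form_skew. Qed.

(** Expand rho(s)(uv) by the derivation rule and move factors across B: the result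
is - om(vw,u) - om(wu,v). *)
Lemma g2form_jacobi u v w : imag u -> imag v -> imag w -> B u v = 0 -> B u w = 0 -> B v w = 0 ->
  om (u ** v) w + om (v ** w) u + om (w ** u) v = 0.
Proof.
move=> iu iv iw uv uw vw.
have isx x : imag (rho s x) by exact: (g2_imag hk2 hC hrho).
have [u' uE] := imag_ex hk2 iu.
have der : rho s (u ** v) = rho s u ** v + u ** rho s v.
  by rewrite -uE (g2_derivation hk2 hC hrho).
have wu : B w u = 0 by rewrite octBC.
rewrite der octBDl (octB_skewr hk2 _ _ iv) (octB_skewl hk2 _ _ iu).
rewrite (anticomm hk2 iw iv) ?(anticomm hk2 iu iw) // ?octBNr ?opprK; last by rewrite octBC.
rewrite (g2form_skew (mul_imag hk2 iv iw vw) iu) (g2form_skew (mul_imag hk2 iw iu wu) iv).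
ring.
Qed.

Variables (x y z : O) (xyz : cayley_triple x y z).
Local Notation e := (nth 0 (frame x y z)).
Local Notation W i j := (om (e i%N) (e j%N)).
Local Notation a := (q x).
Local Notation b := (q y).
Local Notation c := (q z).

Definition g2form_coef i j := W i j.

(** Seven instances of [g2form_jacobi], one for each of the omitted indices: they
are the linear equations of the Lie algebra of type G2 in that of so(7). *)
Lemma g2form_frame : let W := g2form_coef in
  [/\ W 3 4 = W 1 6 - W 2 5, W 3 5 = W 1 7 + a * W 2 4, W 3 6 = W 2 7 - b * W 1 4 &
   [/\ W 3 7 = - (b * W 1 5) - a * W 2 6, W 5 6 = W 4 7 + c * W 1 2,
      W 5 7 = c * W 1 3 - a * W 4 6 & W 6 7 = c * W 2 3 + b * W 4 5]].
Proof.
have J i j l : (0 < i < 8)%N -> (0 < j < 8)%N -> (0 < l < 8)%N -> i != j -> i != l -> j != l ->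
    om (e i ** e j) (e l) + om (e j ** e l) (e i) + om (e l ** e i) (e j) = 0.
  move=> hi hj hl ij il jl; have im := frame_imag hk2 xyz.
  move: (hi) (hj) (hl) => /andP[_ i8] /andP[_ j8] /andP[_ l8].
  by apply: g2form_jacobi; rewrite ?(frame_orth hk2 xyz) //; apply: im.
pose cf i j := nth 0 (nth [::] (frame_coefs a b c) i) j.
pose m i j := nth 0%N (nth [::] frame_index i) j.
have {}J i j l : (0 < i < 8)%N -> (0 < j < 8)%N -> (0 < l < 8)%N ->
    i != j -> i != l -> j != l ->
    cf i j * W (m i j) l + cf j l * W (m j l) i + cf l i * W (m l i) j = 0.
  move=> hi hj hl ij il jl; rewrite -[RHS](J i j l) //.
  move: hi hj hl => /andP[_ i8] /andP[_ j8] /andP[_ l8].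
  by rewrite !(frame_mul hk2 xyz) // !linearZ !octBZl.
have sk i j : (0 < i < 8)%N -> (0 < j < 8)%N -> W i j = - W j i.
  by move=> hi hj; apply: g2form_skew; exact: (frame_imag hk2 xyz).
have h34 := J 1 2 4 isT isT isT isT isT isT.
have h35 := J 1 2 5 isT isT isT isT isT isT.
have h36 := J 1 2 6 isT isT isT isT isT isT.
have h37 := J 1 2 7 isT isT isT isT isT isT.
have h56 := J 1 4 6 isT isT isT isT isT isT.
have h57 := J 1 4 7 isT isT isT isT isT isT.
have h67 := J 2 4 7 isT isT isT isT isT isT.
rewrite /cf /m {J cf m} /= in h34 h35 h36 h37 h56 h57 h67.
rewrite /g2form_coef; split; last split.
- apply: (eq_lincomb (c := 1) h34); rewrite (sk 6 1) // (sk 5 2) //; ring.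
- apply: (eq_lincomb (c := 1) h35); rewrite (sk 7 1) // (sk 4 2) //; ring.
- apply: (eq_lincomb (c := 1) h36); rewrite (sk 4 1) // (sk 7 2) //; ring.
- apply: (eq_lincomb (c := 1) h37); rewrite (sk 5 1) // (sk 6 2) //; ring.
- apply: (eq_lincomb (c := 1) h56); rewrite (sk 2 1) // (sk 7 4) //; ring.
- apply: (eq_lincomb (c := 1) h57); rewrite (sk 3 1) // (sk 6 4) //; ring.
- apply: (eq_lincomb (c := 1) h67); rewrite (sk 3 2) // (sk 5 4) //; ring.
Qed.

(** The scalar summands of mu o psi and of Q /\ mu, with their constant factors
removed, paired with s. *)
Definition assoc_form (v : seq V) : k := let w := fun i => vsval (nth 0 v i) in
  om (assoc (w 0%N) (w 1%N) (w 2)) (assoc (w 3) (w 4) (w 5)).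

Definition coassoc_form (v : seq V) : k := let w := fun i => vsval (nth 0 v i) in
  B (w 0%N) (assoc (w 1%N) (w 2) (w 3)) * om (w 4) (w 5).

Lemma rho_linear r u v : rho s (r *: u + v) = r *: rho s u + rho s v.
Proof. by rewrite linearP. Qed.

Lemma assoc_form_multilinear : seq_multilinear 6 (assoc_form : seq V -> k^o).
Proof.
move=> s1 s2 r u v [] sz; rewrite /assoc_form.
case: s1 s2 sz => [|? [|? [|? [|? [|? [|? ?]]]]]] s2 //= _.
all: by rewrite ?(assocPl, assocPm, assocPr) ?rho_linear ?(octBPl, octBPr).
Qed.

Lemma coassoc_form_multilinear : seq_multilinear 6 (coassoc_form : seq V -> k^o).
Proof.
move=> s1 s2 r u v [] sz; rewrite /coassoc_form.
case: s1 s2 sz => [|? [|? [|? [|? [|? [|? ?]]]]]] s2 //= _.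
all: rewrite ?(assocPl, assocPm, assocPr) ?rho_linear ?(octBPl, octBPr).
all: by [rewrite mulrDl -mulrA | rewrite mulrDr mulrCA].
Qed.

Lemma assoc_form_alternating : block_alternating 3 6 assoc_form.
Proof.
move=> s1 s2 r [] sz; rewrite /assoc_form.
case: s1 s2 sz => [|? [|? [|? [|? [|? ?]]]]] s2 //= _ _;
  by rewrite ?((assoc_xx hk2), (assoc_yy hk2)) // ?linear0 ?octB0l ?octB0r.
Qed.

Lemma coassoc_form_alternating : block_alternating 4 6 coassoc_form.
Proof.
move=> s1 s2 r [] sz; rewrite /coassoc_form.
case: s1 s2 sz => [|? [|? [|? [|? [|? ?]]]]] s2 //= _ _;
  by rewrite ?((assoc_xx hk2), (assoc_yy hk2), (octB_assoc_xx hk2)) // ?octB0r ?mul0r ?g2form_xx ?mulr0.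
Qed.

(** Normal form of a skew matrix whose row 0 vanishes: only entries above the
diagonal remain, so that proportional terms become syntactically equal. *)
Definition skew_ext (U : nat -> nat -> k) i j : k :=
  if (i == 0%N) || (j == 0%N) then 0 else
  if (i < j)%N then U i j else if (j < i)%N then - U j i else 0.

Lemma g2form_skew_ext i j : (i < 8)%N -> (j < 8)%N ->
  W i j = skew_ext g2form_coef i j.
Proof.
move=> i8 j8; rewrite /skew_ext; case: eqVneq => [->|i0] /=; first exact: g2form_1l.
case: eqVneq => [->|j0]; first exact: g2form_1r.
have im l : (l < 8)%N -> l != 0%N -> imag (e l).
  by move=> l8 l0; apply: (frame_imag hk2 xyz); rewrite lt0n l0.
by case: ltngtP => // [_|->]; [rewrite g2form_skew //; apply: im | apply/g2form_xx/im].
Qed.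

Local Notation cf i j := (nth 0 (nth [::] (frame_coefs a b c) i) j).
Local Notation m i j := (nth 0%N (nth [::] frame_index i) j).
Local Notation ac i j l := (cf i j * cf (m i j) l - cf j l * cf i (m j l)).
Local Notation f := (imframe x y z).
Local Notation U := (skew_ext g2form_coef).

Lemma assoc_form_frame i j l r t u : all (fun i => (i < 7)%N) [:: i; j; l; r; t; u] ->
  assoc_form [:: f i; f j; f l; f r; f t; f u] =
  ac i.+1 j.+1 l.+1 * ac r.+1 t.+1 u.+1 *
  U (m (m i.+1 j.+1) l.+1) (m (m r.+1 t.+1) u.+1).
Proof.
case/and5P=> i7 j7 l7 r7 /and3P[t7 u7 _].
rewrite /assoc_form /= !(imframeE hk2 xyz) // !(frame_assoc hk2 xyz) //.
by rewrite linearZ octBZl octBZr mulrA g2form_skew_ext ?frame_index_lt.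
Qed.

Lemma coassoc_form_frame i j l r t u : all (fun i => (i < 7)%N) [:: i; j; l; r; t; u] ->
  coassoc_form [:: f i; f j; f l; f r; f t; f u] =
  ac j.+1 l.+1 r.+1 *
  (if i.+1 == m (m j.+1 l.+1) r.+1 then nth 0 (frame_norms a b c) i.+1 else 0) *
  U t.+1 u.+1.
Proof.
case/and5P=> i7 j7 l7 r7 /and3P[t7 u7 _].
rewrite /coassoc_form /= !(imframeE hk2 xyz) // !(frame_assoc hk2 xyz) //.
by rewrite octBZr (frame_B hk2 xyz) ?frame_index_lt // g2form_skew_ext.
Qed.

Lemma shuffle_sum_frame_eq0 p (F : seq V -> k) : p \in [:: 3; 4]%N ->
  seq_multilinear 6 (F : seq V -> k^o) -> block_alternating p 6 F ->
  (forall l, l \in subseqs 6 (iota 0 7) -> shuffle_sum p 6 F (map f l) = 0) ->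
  forall v, size v = 6%N -> shuffle_sum p 6 F v = 0.
Proof.
move=> p34 mF bF F0 v v6.
have perm_p : all (fun r => perm_eq r.2 (iota 0 6)) (shuffles p 6).
  by move: p34; rewrite !inE => /orP[] /eqP ->; vm_compute.
apply: (@alternating_eq0 _ _ k^o 6 _ (shuffle_sum_multilinear perm_p mF)
  (shuffle_sum_alternating p34 bF) f 7 _ F0 v v6) => w.
by eexists; apply: (imframe_expand hk2 xyz w).
Qed.

(** On each increasing family of six basis vectors the sum is a multiple of one
of the relations of [g2form_frame]. *)
Lemma assoc_sum_eq0 v : size v = 6%N -> shuffle_sum 3 6 assoc_form v = 0.
Proof.
apply: shuffle_sum_frame_eq0 => // [||l].
- exact: assoc_form_multilinear.
- exact: assoc_form_alternating.
have [h34 h35 h36 [h37 h56 h57 h67]] := g2form_frame.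
rewrite [subseqs _ _]/= !inE /shuffle_sum.
set t := shuffles 3 6; vm_compute in t; rewrite {}/t !big_cons big_nil.
do 6?case/predU1P => [->|]; last move/eqP ->; rewrite /= !assoc_form_frame //.
all: rewrite /skew_ext /=; move: g2form_coef h34 h35 h36 h37 h56 h57 h67.
all: move=> w h34 h35 h36 h37 h56 h57 h67.
all: by rewrite ?h34 ?h35 ?h36 ?h37 ?h56 ?h57 ?h67; ring.
Qed.

Lemma coassoc_sum_eq0 v : size v = 6%N -> shuffle_sum 4 6 coassoc_form v = 0.
Proof.
apply: shuffle_sum_frame_eq0 => // [||l].
- exact: coassoc_form_multilinear.
- exact: coassoc_form_alternating.
have [h34 h35 h36 [h37 h56 h57 h67]] := g2form_frame.
rewrite [subseqs _ _]/= !inE /shuffle_sum.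
set t := shuffles 4 6; vm_compute in t; rewrite {}/t !big_cons big_nil.
do 6?case/predU1P => [->|]; last move/eqP ->; rewrite /= !coassoc_form_frame //.
all: rewrite /skew_ext /=; move: g2form_coef h34 h35 h36 h37 h56 h57 h67.
all: move=> w h34 h35 h36 h37 h56 h57 h67.
all: by rewrite ?h34 ?h35 ?h36 ?h37 ?h56 ?h57 ?h67; ring.
Qed.
End Derivation.

Lemma arguments_one_line (v : 6.-tuple V) (s : 'S_6) :
  [tuple tnth v (s i) | i < 6] = map (nth 0 v) (one_line s) :> seq V.
Proof.
by rewrite -map_comp; apply: eq_map => i /=; rewrite (tnth_nth 0).
Qed.

Lemma mu_circ_psi_eq0 (v : 6.-tuple V) : mu_circ_psi rho mu v = 0.
Proof.
have [x ix qx] := imag_anisotropic hk2 O.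
have [y [z xyz]] := cayley_triple_extend hk2 ix qx.
pose psi l i := let w := map (nth 0 v) l in
  psi_im rho mu (nth 0 w i) (nth 0 w i.+1) (nth 0 w i.+2).
rewrite /mu_circ_psi; under eq_bigr do rewrite /= !arguments_one_line.
rewrite (@sum_shuffles _ 3 6 (fun b l => (-1) ^+ b *: mu (psi l 0%N) (psi l 3%N))).
apply: (mu_sum_eq0 (c := fun r => _) (a := fun r => psi r.2 0%N) (b := fun r => psi r.2 3%N)) => s gs.
transitivity ((3%:R / 4%:R) ^+ 2 * shuffle_sum 3 6 (assoc_form s) v); last first.
  by rewrite (assoc_sum_eq0 gs xyz) ?mulr0 ?size_tuple.
rewrite /shuffle_sum mulr_sumr; apply: eq_bigr => r _.
rewrite !(psi_imE hk2 hk3 hC hrho hmu) /assoc_form linearZ octBZl octBZr.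
ring.
Qed.

Lemma Q_wedge_mu_eq0 (v : 6.-tuple V) : Q_wedge_mu rho mu v = 0.
Proof.
have [x ix qx] := imag_anisotropic hk2 O.
have [y [z xyz]] := cayley_triple_extend hk2 ix qx.
pose w l i := nth 0 (map (nth 0 v) l) i : V.
rewrite /Q_wedge_mu; under eq_bigr do rewrite /= !arguments_one_line.
rewrite (@sum_shuffles _ 4 6 (fun b l => ((-1) ^+ b *
  Q_im rho mu (w l 0%N) (w l 1%N) (w l 2) (w l 3)) *: mu (w l 4) (w l 5))).
apply: (mu_sum_eq0 (c := fun r => _) (a := fun r => w r.2 4) (b := fun r => w r.2 5)) => s gs.
transitivity (- 3%:R * shuffle_sum 4 6 (coassoc_form s) v); last first.
  by rewrite (coassoc_sum_eq0 gs xyz) ?mulr0 ?size_tuple.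
rewrite /shuffle_sum mulr_sumr; apply: eq_bigr => r _.
by rewrite (Q_imE hk2 hk3 hC hrho hmu) /coassoc_form; ring.
Qed.

End DegreeSix.

Theorem proposition4p5 (k : fieldType) (hk2 : (2 \notin [pchar k])%N)
    (hk3 : (3 \notin [pchar k])%N) (O : octonionAlg k)
    (C : algType k) (iota : {linear imO O -> C})
    (hC : is_clifford_algebra (fun u : imO O => - imq u) iota)
    (rho : {linear C -> 'End(O)}) (hrho : is_clifford_action iota rho)
    (mu : imO O -> imO O -> C) (hmu : is_moment_map iota rho mu) :
  [/\ (* a *)
      forall v1 v2 v3 : imO O,
        vsval (psi_im rho mu v1 v2 v3)
        = - (3%:R / 4%:R) *: oct_assoc (vsval v1) (vsval v2) (vsval v3),
      (* b *)
      forall v1 v2 v3 v4 : imO O,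
        Q_im rho mu v1 v2 v3 v4
        = - 3%:R * octB (vsval v1) (oct_assoc (vsval v2) (vsval v3) (vsval v4)),
      (* c *)
      forall (L : vectType k) (wedge : 4.-tuple (imO O) -> L)
             (hL : is_exterior_power wedge)
             (eta : 'Hom(L, 'Hom(L, k^o))) (heta : is_eta wedge eta)
             (Q : 'Hom(L, k^o))
             (hQ : forall v1 v2 v3 v4 : imO O,
                Q (wedge [tuple v1; v2; v3; v4]) = Q_im rho mu v1 v2 v3 v4)
             (e1 e2 e3 e4 e5 e6 e7 : imO O)
             (he : is_cayley_basis e1 e2 e3 e4 e5 e6 e7),
        (eta^-1)%VF Q
        = (6%:R / (imq e1 * imq e2 * imq e4)) *: wedge [tuple e1; e2; e4; e7]
        - (6%:R / (imq e1 * imq e2 * imq e4)) *: wedge [tuple e1; e2; e5; e6]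
        - (6%:R / (imq e1 * imq e2 * imq e4)) *: wedge [tuple e1; e3; e4; e6]
        - (6%:R / (imq e1 ^+ 2 * imq e2 * imq e4)) *: wedge [tuple e1; e3; e5; e7]
        + (6%:R / (imq e1 * imq e2 * imq e4)) *: wedge [tuple e2; e3; e4; e5]
        - (6%:R / (imq e1 * imq e2 ^+ 2 * imq e4)) *: wedge [tuple e2; e3; e6; e7]
        - (6%:R / (imq e1 * imq e2 * imq e4 ^+ 2)) *: wedge [tuple e4; e5; e6; e7]
    & (* d *)
      (forall v : 6.-tuple (imO O), mu_circ_psi rho mu v = 0)
      /\ (forall v : 6.-tuple (imO O), Q_wedge_mu rho mu v = 0)].
Proof.
split.
- exact: (psi_imE hk2 hk3 hC hrho hmu).
- exact: (Q_imE hk2 hk3 hC hrho hmu).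
- move=> L wedge hL eta heta Q hQ e1 e2 e3 e4 e5 e6 e7 he.
  apply: (eta_inv_form hk2 hL heta) => // v1 v2 v3 v4.
  by rewrite hQ (Q_imE hk2 hk3 hC hrho hmu).
- split=> v; first exact: (mu_circ_psi_eq0 hk2 hk3 hC hrho hmu).
  exact: (Q_wedge_mu_eq0 hk2 hk3 hC hrho hmu).
Qed.
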